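(* There exists an absolute constant $\kappa>0$ such that for every $c\ge\kappa$ and every $\rho>0$ there exists a constant $C>0$, depending only on $\rho$ and $c$, with the following property. For all integers $N\ge1$ and $r\ge2$, with $n=2^N$, and every mean matrix $s$ such that $s_i^{(j)}\le1-\rho$ for all $i\in\{1,\dots,n\}$, $j\in\{1,\dots,r\}$, the estimator $\tilde s$ computed with the NEH strategy (with constant $c$ in the penalty) satisfies $$\mathbb{E}_s\|s-\tilde s\|^2\le C\inf_{m\in\mathcal{M}}\mathbb{E}_s\|s-\hat s_m\|^2 .$$
   Context: Model. $n=2^N$ with an integer $N\ge1$, and $r\ge2$ is an integer. $X_1,\dots,X_n$ are independent random column vectors, $X_i\in\{0,1\}^r$ with components summing to one. $X$ is the $r\times n$ random matrix with $i$th column $X_i$ and $s$ is its expectation (so each column of $s$ is a probability on $\{1,\dots,r\}$, and $s$ determines the law of $X$). $\mathbb{P}_s,\mathbb{E}_s$ denote probability and expectation when the mean of $X$ is $s$. For an $r\times n$ matrix $t$, $t^{(j)}$ is its $j$th line (a vector of $\mathbb{R}^n$), $t_i$ its $i$th column, $t_i^{(j)}$ its $(j,i)$ entry; $\langle t,t'\rangle=\sum_{i,j}t_i^{(j)}t_i'^{(j)}$ and $\|\cdot\|$ is the associated norm. For a linear subspace $S\subset\mathbb{R}^n$, $\mathbb{R}^r\otimes S$ is the set of $r\times n$ matrices all of whose lines belong to $S$. Haar basis. $\Lambda=\bigcup_{j=-1}^{N-1}\Lambda(j)$ where $\Lambda(-1)=\{(-1,0)\}$ and $\Lambda(j)=\{(j,k):k=0,\dots,2^j-1\}$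 for $j\ge0$. Let $\varphi:\mathbb{R}\to\{-1,0,1\}$ equal $1$ on $(0,1/2]$, $-1$ on $(1/2,1]$ and $0$ elsewhere. For $\lambda\in\Lambda$, $\phi_\lambda\in\mathbb{R}^n$ has $i$th component $1/\sqrt n$ if $\lambda=(-1,0)$ and $\frac{2^{j/2}}{\sqrt n}\varphi\left(2^j\frac in-k\right)$ if $\lambda=(j,k)$ with $j\ge0$. $\{\phi_\lambda,\lambda\in\Lambda\}$ is an orthonormal basis of $\mathbb{R}^n$. Penalized estimator. Given a finite collection $\{S_m,m\in\mathcal{M}\}$ of linear subspaces of $\mathbb{R}^n$ with $D_m=\dim S_m$ and a penalty $\mathrm{pen}:\mathcal{M}\to\mathbb{R}_+$, $\hat s_m$ is the orthogonal projection of $X$ onto $\mathbb{R}^r\otimes S_m$, $\gamma_n(t)=\|t\|^2-2\langle X,t\rangle$, and $\tilde s=\hat s_{\hat m}$ where $\hat m$ minimizes $\gamma_n(\hat s_m)+\mathrm{pen}(m)$ over $m\in\mathcal{M}$. NEH strategy. For $J\in\{0,\dots,N-1\}$, $\mathcal{M}_J$ is the collection of all subsets $m\subset\Lambda$ of the form $m=\left[\bigcup_{j=-1}^{J-1}\Lambda(j)\right]\cup\left[\bigcup_{k=0}^{N-J-1}\Lambda'(J+k)\right]$, where $\Lambda'(J+k)$ is any subset of $\Lambda(J+k)$ with cardinality $\lfloor2^J(k+1)^{-3}\rfloor$ ($\lfloor x\rfloor$ is the integer part of $x$). $\mathcal{M}=\bigcup_{J=0}^{N-1}\mathcal{M}_J$;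 $S_m$ is the linear span of $\{\phi_\lambda,\lambda\in m\}$, so $D_m=|m|$; and $\mathrm{pen}(m)=cD_m$. *)

(* Defs.v *)
From HB Require Import structures.
From mathcomp Require Import all_boot all_order all_algebra.
From mathcomp Require Import all_classical all_reals all_analysis.
Set Implicit Arguments.
Unset Strict Implicit.
Unset Printing Implicit Defensive.
Import Order.TTheory GRing.Theory Num.Theory.
Import numFieldNormedType.Exports.
Local Open Scope classical_set_scope.
Local Open Scope ring_scope.

(* [None] is the index (-1, 0); [Some (existT j k)] is the index (j, k) with
   0 <= j < N and 0 <= k < 2 ^ j. *)
Definition haar_index (N : nat) : finType :=
  option {j : 'I_N & 'I_(2 ^ j)}.

Definition haar_scale N (l : haar_index N) : int :=
  if l is Some jk then (tag jk : nat)%:Z else - 1.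

Definition haar_level N (j : int) : {set haar_index N} :=
  [set l | haar_scale l == j]%SET.

Definition neh_slice N (J : nat) (m : {set haar_index N}) : Prop :=
  exists L' : 'I_(N - J) -> {set haar_index N},
    (forall k : 'I_(N - J),
        L' k \subset haar_level N (J + k)%N%:Z /\
        (* Euclidean division: the floor of 2 ^ J * (k + 1) ^ (-3) *)
        #|L' k| = (2 ^ J %/ k.+1 ^ 3)%N) /\
    m = ((haar_level N (- 1) :|: \bigcup_(j < J) haar_level N (j : nat)%:Z)
         :|: \bigcup_(k < N - J) L' k)%SET.

Definition neh_models N : set {set haar_index N} :=
  [set m | exists J : nat, (J < N)%N /\ neh_slice J m].

Section Geometry.
Variable R : realType.

Definition haar_wavelet (x : R) : R :=
  if 0 < x <= 1 / 2 then 1 else if 1 / 2 < x <= 1 then - 1 else 0.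

(* The coordinate i = 1, ..., n of the vectors is encoded by the ordinal of
   value i - 1, whence [i.+1] below. *)
Definition haar_vec N (l : haar_index N) : 'rV[R]_(2 ^ N) :=
  let n : R := (2 ^ N)%N%:R in
  match l with
  | None => \row_i (1 / Num.sqrt n)
  | Some (existT j k) =>
      \row_i (2 `^ (j%:R / 2) / Num.sqrt n *
              haar_wavelet (2 ^+ j * (i.+1%:R / n) - k%:R))
  end.

Definition haar_span N (m : {set haar_index N}) : {vspace 'rV[R]_(2 ^ N)} :=
  <<[seq haar_vec l | l <- enum m]>>%VS.

Definition mxdot r n (t u : 'M[R]_(r, n)) : R :=
  \sum_(j < r) \sum_(i < n) t j i * u j i.

Definition mxsqnorm r n (t : 'M[R]_(r, n)) : R := mxdot t t.

(* The space R^r (x) S. *)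
Definition rows_in r n (S : {vspace 'rV[R]_n}) : set 'M[R]_(r, n) :=
  [set t | forall j, row j t \in S].

Definition is_orthoproj r n (S : {vspace 'rV[R]_n}) (x p : 'M[R]_(r, n)) :
    Prop :=
  rows_in S p /\ forall t, rows_in S t -> mxdot (x - p) t = 0.

(* The matrix p satisfying [is_orthoproj S x p] exists and is unique, so the
   default value 0 is never used. *)
Definition orthoproj r n (S : {vspace 'rV[R]_n}) (x : 'M[R]_(r, n)) :
    'M[R]_(r, n) :=
  xget 0 [set p | is_orthoproj S x p].

Definition contrast r n (x t : 'M[R]_(r, n)) : R :=
  mxsqnorm t - 2 * mxdot x t.

Definition proj_estimator r N (x : 'M[R]_(r, 2 ^ N)) (m : {set haar_index N}) :
    'M[R]_(r, 2 ^ N) :=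
  orthoproj (haar_span m) x.

Definition penalized_crit (c : R) r N (x : 'M[R]_(r, 2 ^ N))
    (m : {set haar_index N}) : R :=
  contrast x (proj_estimator x m) + c * (\dim (haar_span m))%:R.

Definition minimizes_crit (c : R) r N (x : 'M[R]_(r, 2 ^ N))
    (m : {set haar_index N}) : Prop :=
  neh_models m /\
  forall m', neh_models m' -> penalized_crit c x m <= penalized_crit c x m'.

End Geometry.

Section Sampling.
Context d (T : measurableType d) (R : realType) (P : probability T R).
Variables (r n : nat) (X : T -> 'M[R]_(r, n)).

(* The sigma-algebra generated by the random vector given by column i of X,
   i.e. the one generated by its coordinates. *)
Definition column_sigma (i : 'I_n) : set (set T) :=
  <<s \bigcup_(j in [set: 'I_r])
        preimage_set_system setT (fun w => X w j i) measurable >>.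

Definition independent_columns : Prop :=
  forall (I : {set 'I_n}) (A : 'I_n -> set T),
    (forall i, i \in I -> column_sigma i (A i)) ->
    P (\bigcap_(i in [set` I]) A i) = (\prod_(i in I) P (A i))%E.

Definition categorical_sample (s : 'M[R]_(r, n)) : Prop :=
  [/\ forall j i, measurable_fun setT (fun w => X w j i),
      forall w j i, X w j i = 0 \/ X w j i = 1,
      forall w i, \sum_(j < r) X w j i = 1,
      independent_columns &
      forall j i, 'E_P[fun w => X w j i]%E = (s j i)%:E].

End Sampling.

(* Main.v *)
Require Import Defs.
From HB Require Import structures.
From mathcomp Require Import all_boot all_order all_algebra.
From mathcomp Require Import all_classical all_reals all_analysis.
From mathcomp Require Import measurable_realfun ring lra zify.
Set Implicit Arguments.
Unset Strict Implicit.
Unset Printing Implicit Defensive.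
Import Order.TTheory GRing.Theory Num.Theory.
Import numFieldNormedType.Exports.
Local Open Scope classical_set_scope.
Local Open Scope ring_scope.

(** The loss of the selected estimator is compared, on each outcome, with that
    of an arbitrary model [m]. Minimality of the criterion and the identity
    |X - t|^2 = |s - t|^2 + 2 <X - s, s - t> + |X - s|^2 give, for some absolute
    factors, loss <= bias(m) + chi(m) + c |m| + (chi(m') - c |m'|), where m' is
    the selected model and chi(m) is the squared norm of the projection of the
    noise X - s on the span of [m] ([penalized_loss_le]). Only the last bracket
    involves the random model. It is replaced by the sum of
    exp (chi(m') / 32 - c |m'| / 128) over all the models, and two facts make
    the mean of this sum a constant.

    - The noise is sub-Gaussian with a constant that does not depend on [r]:
      the mean of exp (chi(m) / 32) is at most exp (|m| / 8)
      ([quad_noise_mgf]). The proof works with quadratic forms 0 <= A <= I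
      instead of projections, since they are stable under integration of one
      column of the noise: averaging over column [i] costs a multiple of the
      i-th diagonal entry and changes [A] into a form [integrate_out i A] with
      0 <= integrate_out i A <= I, whose trace is smaller by at least half of
      that entry. Integrating all the columns costs a multiple of the trace,
      which is |m| for the projection on the span of [m].

    - The models are few: the sum of exp (- 6 |m|) over all of them is at most
      one ([kraft_neh]). A model whose full levels are those below [J] has at
      least 2 ^ J elements, and there are exp (O (2 ^ J)) of them, which is seen
      by comparing with a product measure on subsets of the index set under
      which a wavelet of level J + k is chosen with odds exp (- 3 k).

    On the other side the risk of a fixed model is its bias plus the mean of
    chi(m), and column [i] of the noise has squared norm 1 - sum_j (s j i)^2 in
    mean. This is at least [rho] when all the entries of [s] are at most
    1 - rho, so the risk is at least bias(m) + rho |m| ([oracle_risk_ge]).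

    The means are computed as finite sums: the sample takes finitely many
    values and its law is the product of the laws of the columns
    ([expectation_sample]). That dimensions are cardinals and that projections
    are explicit matrices follows from the orthonormality of the Haar vectors
    ([haar_orthonormal]). *)

(** * Inner product of matrices and quadratic forms *)

Section MatrixInnerProduct.
Variable R : realType.
Implicit Types r n : nat.

Lemma mxdotE r n (t u : 'M[R]_(r, n)) : mxdot t u = \tr (t *m u^T).
Proof.
by apply: eq_bigr => j _; rewrite mxE; apply: eq_bigr => i _; rewrite mxE.
Qed.

Lemma mxdotC r n (t u : 'M[R]_(r, n)) : mxdot t u = mxdot u t.
Proof. by apply: eq_bigr => j _; apply: eq_bigr => i _; rewrite mulrC. Qed.

Lemma mxdotDl r n (t t' u : 'M[R]_(r, n)) :
  mxdot (t + t') u = mxdot t u + mxdot t' u.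
Proof. by rewrite !mxdotE mulmxDl mxtraceD. Qed.

Lemma mxdotZl r n k (t u : 'M[R]_(r, n)) : mxdot (k *: t) u = k * mxdot t u.
Proof. by rewrite !mxdotE -scalemxAl mxtraceZ. Qed.

Lemma mxdotNl r n (t u : 'M[R]_(r, n)) : mxdot (- t) u = - mxdot t u.
Proof. by rewrite -scaleN1r mxdotZl mulN1r. Qed.

Lemma mxdotDr r n (t u u' : 'M[R]_(r, n)) :
  mxdot t (u + u') = mxdot t u + mxdot t u'.
Proof. by rewrite mxdotC mxdotDl !(mxdotC t). Qed.

Lemma mxdotZr r n k (t u : 'M[R]_(r, n)) : mxdot t (k *: u) = k * mxdot t u.
Proof. by rewrite mxdotC mxdotZl mxdotC. Qed.

Lemma mxdotNr r n (t u : 'M[R]_(r, n)) : mxdot t (- u) = - mxdot t u.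
Proof. by rewrite mxdotC mxdotNl mxdotC. Qed.

Lemma mxdot0l r n (t : 'M[R]_(r, n)) : mxdot 0 t = 0.
Proof. by rewrite -[in LHS](scale0r (0 : 'M[R]_(r, n))) mxdotZl mul0r. Qed.

Lemma mxdot0r r n (t : 'M[R]_(r, n)) : mxdot t 0 = 0.
Proof. by rewrite mxdotC mxdot0l. Qed.

Definition mxdot_linear :=
  (mxdotDl, mxdotDr, mxdotNl, mxdotNr, mxdotZl, mxdotZr).

Lemma mxdot_adjoint r n p (t : 'M[R]_(r, n)) (A : 'M[R]_(n, p)) (u : 'M[R]_(r, p)) :
  mxdot (t *m A) u = mxdot t (u *m A^T).
Proof. by rewrite !mxdotE trmx_mul trmxK mulmxA. Qed.

Lemma mxsqnorm_ge0 r n (t : 'M[R]_(r, n)) : 0 <= mxsqnorm t.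
Proof.
by apply: sumr_ge0 => j _; apply: sumr_ge0 => i _; rewrite -expr2 sqr_ge0.
Qed.

Lemma mxsqnormN r n (t : 'M[R]_(r, n)) : mxsqnorm (- t) = mxsqnorm t.
Proof. by rewrite /mxsqnorm mxdotNl mxdotNr opprK. Qed.

Lemma mxsqnorm_eq0 r n (t : 'M[R]_(r, n)) : mxsqnorm t = 0 -> t = 0.
Proof.
move=> t0; apply/matrixP => j i; rewrite mxE.
have sq j' i' : 0 <= t j' i' * t j' i' by rewrite -expr2 sqr_ge0.
have /eqP := t0; rewrite psumr_eq0 => [/allP/(_ j)|j' _]; last exact: sumr_ge0.
rewrite mem_index_enum => /(_ isT)/implyP/(_ isT).
rewrite psumr_eq0 => [/allP/(_ i)|//].
by rewrite mem_index_enum => /(_ isT)/implyP/(_ isT); rewrite mulf_eq0 orbb => /eqP.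
Qed.

Lemma mxdot_young r n (t u : 'M[R]_(r, n)) (k : R) : 0 < k ->
  2 * mxdot t u <= k * mxsqnorm t + k^-1 * mxsqnorm u.
Proof.
move=> k0; have := mxsqnorm_ge0 (k *: t - u).
rewrite /mxsqnorm !mxdot_linear (mxdotC u t) => h.
rewrite -subr_ge0 -(pmulr_rge0 _ k0).
have -> : k * (k * mxdot t t + k^-1 * mxdot u u - 2 * mxdot t u) =
  k * (k * mxdot t t) - 2 * k * mxdot t u + mxdot u u * (k * k^-1) by ring.
rewrite mulfV ?gt_eqF //; lra.
Qed.

(** Expanding |2 v - <v, t> t|^2 >= 0 gives this case of the Cauchy-Schwarz
    inequality without a division by the norm of [t]. *)
Lemma mxdot_sqr_le r n (v t : 'M[R]_(r, n)) : mxsqnorm t <= 2 ->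
  mxdot v t ^+ 2 <= 2 * mxsqnorm v.
Proof.
move=> t2; have := mxsqnorm_ge0 (2 *: v - mxdot v t *: t).
rewrite /mxsqnorm !mxdot_linear (mxdotC t v) -!/(mxsqnorm _).
have := sqr_ge0 (mxdot v t).
set z := mxdot v t => z0 h; have := ler_wpM2l z0 t2; nra.
Qed.

Definition quad r n (A : 'M[R]_n) (t : 'M[R]_(r, n)) : R := mxdot (t *m A) t.

(** The condition 0 <= A <= I, tested on stacks of [r] rows because this is the
    shape of the noise. *)
Definition contraction r n (A : 'M[R]_n) : Prop :=
  A^T = A /\ forall t : 'M[R]_(r, n), 0 <= quad A t <= mxsqnorm t.

Definition erase n (i : 'I_n) : 'M[R]_n :=
  1%:M - (delta_mx (0 : 'I_1) i)^T *m delta_mx 0 i.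

(** The form left after averaging over the noise [t] of column [i]. Write [y] for
    the rest of the noise and [u] for column [i] of [A]. The cross term
    2 <y u, t> of the form is centred in [t] and sub-Gaussian, so that it costs
    a multiple of |y u|^2, which is a rank-one form in [y]. The coefficient 1/2
    keeps the form below the identity while its trace decreases. *)
Definition integrate_out n (i : 'I_n) (A : 'M[R]_n) : 'M[R]_n :=
  erase i *m (A + 2^-1 *: (col i A *m (col i A)^T)) *m erase i.

Section Erase.
Variables (n : nat) (i : 'I_n).
Local Notation e := (delta_mx (0 : 'I_1) i : 'rV[R]_n).

Lemma tr_erase : (erase i)^T = erase i.
Proof. by rewrite linearB /= trmx1 trmx_mul trmxK. Qed.

Lemma delta_norm : e *m e^T = 1%:M.
Proof. by rewrite trmx_delta mul_delta_mx; apply/matrixP=> a b; rewrite !ord1 !mxE. Qed.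

Lemma erase_idem : erase i *m erase i = erase i.
Proof.
rewrite {1}/erase mulmxBl mul1mx /erase mulmxBr mulmx1.
by rewrite -mulmxA (mulmxA e) delta_norm mul1mx subrr subr0.
Qed.

Lemma erase_delta : erase i *m e^T = 0.
Proof. by rewrite mulmxBl mul1mx -mulmxA delta_norm mulmx1 subrr. Qed.

Lemma split_coord r (t : 'M[R]_(r, n)) : t = t *m erase i + col i t *m e.
Proof.
by rewrite mulmxBr mulmx1 (_ : col i t = t *m e^T) ?mulmxA ?subrK // trmx_delta colE.
Qed.

Lemma mx11_entry (A : 'M[R]_n) : e *m A *m e^T = (A i i)%:M.
Proof.
by rewrite trmx_delta -colE -rowE; apply/matrixP=> a b; rewrite !ord1 !mxE.
Qed.

Lemma quad_split r (A : 'M[R]_n) (y : 'M[R]_(r, n)) (t : 'cV[R]_r) :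
  A^T = A ->
  quad A (y + t *m e) =
  quad A y + 2 * mxdot (y *m col i A) t + A i i * mxsqnorm t.
Proof.
move=> As; rewrite /quad mulmxDl !mxdot_linear.
have -> : mxdot (t *m e *m A) y = mxdot (y *m col i A) t.
  by rewrite -mulmxA mxdot_adjoint trmx_mul As mxdotC trmx_delta colE.
have -> : mxdot (y *m A) (t *m e) = mxdot (y *m col i A) t.
  by rewrite mxdotC mxdot_adjoint mxdotC colE trmx_delta mulmxA.
rewrite [mxdot (_ *m _ *m _) (t *m e)]mxdotC (mxdot_adjoint t) -!(mulmxA t) mx11_entry.
rewrite mul_mx_scalar mxdotZr /mxsqnorm; ring.
Qed.

Lemma quad_integrate_out r (A : 'M[R]_n) (t : 'M[R]_(r, n)) :
  quad (integrate_out i A) t =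
  quad A (t *m erase i) + 2^-1 * mxsqnorm (t *m erase i *m col i A).
Proof.
rewrite /quad /integrate_out !mulmxA mxdot_adjoint tr_erase mulmxDr mxdotDl.
by rewrite -scalemxAr mxdotZl mulmxA [mxdot (_ *m _^T) _]mxdot_adjoint trmxK.
Qed.

Lemma mxsqnorm_erase r (t : 'M[R]_(r, n)) :
  mxsqnorm (t *m erase i) <= mxsqnorm t.
Proof.
rewrite [in leRHS](split_coord t) /mxsqnorm [leRHS]mxdotDl !mxdotDr.
have orth : mxdot (col i t *m e) (t *m erase i) = 0.
  by rewrite mxdot_adjoint -mulmxA erase_delta mulmx0 mxdot0r.
rewrite orth [mxdot _ (col i t *m e)]mxdotC orth addr0 add0r.
by rewrite lerDl mxsqnorm_ge0.
Qed.

Lemma contraction_row r (A : 'M[R]_n) : contraction r.+1 A -> contraction 1 A.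
Proof.
move=> [As Ac]; split=> // w.
pose d : 'cV[R]_r.+1 := delta_mx 0 0.
have dE (a b : 'rV[R]_n) : mxdot (d *m a) (d *m b) = mxdot a b.
  rewrite !mxdotE trmx_mul mulmxA mxtrace_mulC !mulmxA.
  rewrite trmx_delta mul_delta_mx (_ : delta_mx 0 0 = 1%:M) ?mul1mx //.
  by apply/matrixP => x y; rewrite !ord1 !mxE.
by have := Ac (d *m w); rewrite /quad /mxsqnorm -mulmxA !dE.
Qed.

Lemma contraction_diag_ge0 r (A : 'M[R]_n) : contraction r.+1 A -> 0 <= A i i.
Proof.
move=> /contraction_row[As /(_ e)/andP[]].
by rewrite /quad mxdotE mx11_entry mxtrace_scalar.
Qed.

(** This is A^2 <= A on the diagonal. With [u] the column and [e] the unit vector,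
    it follows from A >= 0 at u - e and A <= I at [u], without a square root of
    [A]. *)
Lemma contraction_col_norm r (A : 'M[R]_n) :
  contraction r.+1 A -> mxsqnorm (col i A) <= A i i.
Proof.
move=> /contraction_row[As Ac]; set u := col i A.
have /andP[+ _] := Ac (u^T + (- 1%:M) *m e); have /andP[_] := Ac (u^T).
rewrite quad_split // mxdotNr mxdot_adjoint mul1mx.
have -> : mxdot (u^T) (u^T) = mxsqnorm u by rewrite mxdotE trmxK mxtrace_mulC -mxdotE.
have -> : mxsqnorm (- 1%:M : 'M[R]_1) = 1.
  by rewrite /mxsqnorm !mxdot_linear opprK mxdotE trmx1 mulmx1 mxtrace1.
have -> : mxsqnorm (u^T) = mxsqnorm u by rewrite /mxsqnorm !mxdotE trmxK mxtrace_mulC.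
lra.
Qed.

(** Testing the contraction [A] at [y + (y u) e], where [y] has a vanishing
    coordinate [i] and [u] is column [i] of [A], leaves room for twice the term
    that [integrate_out] adds. *)
Lemma contraction_integrate_out r (A : 'M[R]_n) :
  contraction r.+1 A -> contraction r.+1 (integrate_out i A).
Proof.
move=> cA; have [As Ac] := cA; have A0 := contraction_diag_ge0 cA; split.
  by rewrite /integrate_out !trmx_mul tr_erase mulmxA [(_ + _)^T]linearD /=
    [(_ *: _)^T]linearZ /= trmx_mul trmxK As.
move=> t; rewrite quad_integrate_out; set y := t *m erase i.
set v := y *m col i A.
have v0 := mxsqnorm_ge0 v; have /andP[y0 _] := Ac y.
have /andP[_] := Ac (y + v *m e); rewrite quad_split // -/v -/(mxsqnorm v).
have -> : mxsqnorm (y + v *m e) = mxsqnorm y + mxsqnorm v.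
  have orth : mxdot (v *m e) y = 0.
    by rewrite mxdot_adjoint -mulmxA erase_delta mulmx0 mxdot0r.
  rewrite /mxsqnorm !mxdot_linear (mxdotC y (v *m e)) orth !(addr0, add0r).
  by congr (_ + _); rewrite mxdot_adjoint -mulmxA delta_norm mulmx1.
have yt : mxsqnorm y <= mxsqnorm t := mxsqnorm_erase t.
have := mulr_ge0 A0 v0; lra.
Qed.

(** Erasing removes the diagonal entry and the rank-one term restores at most half
    of it, by [contraction_col_norm]. *)
Lemma trace_integrate_out r (A : 'M[R]_n) : contraction r.+1 A ->
  \tr (integrate_out i A) <= \tr A - 2^-1 * A i i.
Proof.
move=> cA; have uA := contraction_col_norm cA; have [As _] := cA.
rewrite /integrate_out mxtrace_mulC mulmxA erase_idem /erase mulmxBl mul1mx.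
rewrite linearB /= -mulmxA [X in _ - X]mxtrace_mulC.
rewrite linearD linearZ /= -mxdotE -/(mxsqnorm _).
rewrite mx11_entry mxtrace_scalar !mxE big_ord1 !mxE.
have := sqr_ge0 (A i i); rewrite expr2; lra.
Qed.

Lemma col0_integrate_out (A : 'M[R]_n) : col i (integrate_out i A) = 0.
Proof. by rewrite colE /integrate_out -!mulmxA -trmx_delta erase_delta !mulmx0. Qed.


Lemma col_integrate_out (A : 'M[R]_n) k :
  A^T = A -> col k A = 0 -> col k (integrate_out i A) = 0.
Proof.
move=> As; have [-> _|ki] := eqVneq k i; first exact: col0_integrate_out.
rewrite !colE; set d := delta_mx k 0 => Ak.
have ek : erase i *m d = d.
  rewrite mulmxBl mul1mx trmx_delta -mulmxA mul_delta_mx_cond eq_sym (negbTE ki).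
  by rewrite mulr0n mulmx0 subr0.
have uk : (col i A)^T *m d = 0 by rewrite colE trmx_mul As -mulmxA Ak mulmx0.
rewrite /integrate_out -mulmxA ek -mulmxA [(_ + _) *m d]mulmxDl -scalemxAl
  -[_ *m _^T *m d]mulmxA uk.
by rewrite Ak mulmx0 scaler0 addr0 mulmx0.
Qed.

End Erase.
End MatrixInnerProduct.

(** * Product laws on labels and exponential moments of the noise *)

Section ProductExpectation.
Variables (R : realType) (r n : nat) (s : 'M[R]_(r, n)).
Hypothesis s_ge0 : forall a i, 0 <= s a i.
Hypothesis s_sum1 : forall i, \sum_a s a i = 1.
Local Notation labels := {ffun 'I_n -> 'I_r}.

(** The expectation of [g] when the labels are independent and label [i] has law
    given by column [i] of [s]. *)
Definition prodE (g : labels -> R) : R := \sum_(f : labels) (\prod_i s (f i) i) * g f.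

Definition relabel (f : labels) (i : 'I_n) (a : 'I_r) : labels :=
  [ffun k => if k == i then a else f k].

Lemma prod_ge0 (f : labels) : 0 <= \prod_i s (f i) i.
Proof. exact: prodr_ge0. Qed.

Lemma prodE_le (g h : labels -> R) : (forall f, g f <= h f) -> prodE g <= prodE h.
Proof. by move=> gh; apply: ler_sum => f _; rewrite ler_wpM2l ?prod_ge0. Qed.

Lemma eq_prodE (g h : labels -> R) : g =1 h -> prodE g = prodE h.
Proof. by move=> gh; apply: eq_bigr => f _; rewrite gh. Qed.

Lemma prodED (g h : labels -> R) :
  prodE (fun f => g f + h f) = prodE g + prodE h.
Proof. by rewrite /prodE -big_split; apply: eq_bigr => f _; rewrite mulrDr. Qed.

Lemma prodEZ k (g : labels -> R) : prodE (fun f => k * g f) = k * prodE g.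
Proof. by rewrite /prodE mulr_sumr; apply: eq_bigr => f _; rewrite mulrCA. Qed.

Lemma prodE_sum (I : Type) (l : seq I) (P : pred I) (g : I -> labels -> R) :
  prodE (fun f => \sum_(i <- l | P i) g i f) = \sum_(i <- l | P i) prodE (g i).
Proof. by rewrite exchange_big; apply: eq_bigr => f _; rewrite mulr_sumr. Qed.

Lemma prodE_cst k : prodE (fun=> k) = k.
Proof.
rewrite /prodE -mulr_suml.
rewrite -(bigA_distr_bigA (fun i a => s a i)) /=.
by rewrite big1 ?mul1r // => i _; exact: s_sum1.
Qed.

(** Drawing the label of [i] a second time, independently of the others, does
    not change the law: the exchange of the two draws preserves the product
    weights. *)
Lemma prodE_relabel i (g : labels -> R) :
  prodE g = prodE (fun f => \sum_a s a i * g (relabel f i a)).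
Proof.
have splitp (f : labels) : \prod_k s (f k) k = s (f i) i * \prod_(k | k != i) s (f k) k.
  by rewrite (bigD1 i).
pose swap (u : labels * 'I_r) := (relabel u.1 i u.2, u.1 i).
have swapK : involutive swap.
  move=> [f a]; congr (_, _) => /=; last by rewrite ffunE eqxx.
  by apply/ffunP => k; rewrite !ffunE; case: eqP => // ->.
transitivity (\sum_(u : labels * 'I_r) (\prod_k s (u.1 k) k) * s u.2 i * g u.1).
  rewrite -(pair_bigA _ (fun (f : labels) a => (\prod_k s (f k) k) * s a i * g f)) /=.
  apply: eq_bigr => f _; rewrite -[LHS]mulr1 -(s_sum1 i) mulr_sumr.
  by apply: eq_bigr => a _; rewrite mulrAC.
rewrite (reindex_inj (inv_inj swapK)) /=.
rewrite -(pair_bigA _ (fun (f : labels) a => (\prod_k s (relabel f i a k) k) * s (f i) i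
   * g (relabel f i a))) /=.
apply: eq_bigr => f _; rewrite mulr_sumr; apply: eq_bigr => a _.
rewrite mulrA; congr (_ * _); rewrite !splitp ffunE eqxx.
rewrite (eq_bigr (fun k => s (f k) k)) => [|k /negbTE ki]; last by rewrite ffunE ki.
by ring.
Qed.

Definition noise (f : labels) : 'M[R]_(r, n) :=
  \matrix_(a, i) ((f i == a)%:R - s a i).

Definition label_noise (i : 'I_n) (a : 'I_r) : 'cV[R]_r :=
  \col_b ((a == b)%:R - s b i).

Lemma noise_relabel f i a :
  noise (relabel f i a) =
  noise f *m erase R i + label_noise i a *m delta_mx 0 i.
Proof.
rewrite [LHS](split_coord i); congr (_ + _); last first.
  by congr (_ *m _); apply/colP => b; rewrite !mxE ffunE eqxx.
apply/matrixP => b k; rewrite !mxE; apply: eq_bigr => l _.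
have [->|li] := eqVneq l i; last by rewrite !mxE ffunE (negbTE li).
rewrite [erase R i i k](_ : _ = 0) ?mulr0 //.
rewrite !mxE big_ord1 !mxE !eqxx /= eq_sym.
by case: (k == i); rewrite ?mulr1 ?mulr0 subrr.
Qed.

Lemma label_noise_mean i : \sum_a s a i *: label_noise i a = 0.
Proof.
apply/colP => b; rewrite summxE mxE.
under eq_bigr => a _ do rewrite !mxE mulrBr.
rewrite sumrB -mulr_suml s_sum1 mul1r (bigD1 b) //= eqxx mulr1 big1 ?addr0 ?subrr //.
by move=> a /negbTE ->; rewrite mulr0.
Qed.

Lemma label_noise_sqnorm i a :
  mxsqnorm (label_noise i a) = 1 - 2 * s a i + \sum_b s b i ^+ 2.
Proof.
rewrite /mxsqnorm /mxdot; under eq_bigr => b _ do rewrite big_ord1 !mxE.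
have -> : 1 - 2 * s a i = \sum_b (a == b)%:R * (1 - 2 * s b i).
  rewrite (bigD1 a) //= eqxx mul1r big1 ?addr0 // => b.
  by rewrite eq_sym => /negbTE ->; rewrite mul0r.
rewrite -big_split /=; apply: eq_bigr => b _.
by case: (a == b) => /=; ring.
Qed.

Lemma mean_le1 a i : s a i <= 1.
Proof. by rewrite -(s_sum1 i) (bigD1 a) //= lerDl sumr_ge0. Qed.

Lemma collision_le1 i : \sum_b s b i ^+ 2 <= 1.
Proof.
rewrite -[leRHS](s_sum1 i); apply: ler_sum => b _.
by rewrite expr2 ler_piMl ?mean_le1.
Qed.

Lemma label_noise_sqnorm_le2 i a : mxsqnorm (label_noise i a) <= 2.
Proof. rewrite label_noise_sqnorm; have := s_ge0 a i; have := collision_le1 i; lra. Qed.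

(** Averaging over a centred [y] removes the linear term, so that this bound
    yields sub-Gaussian moments. For y >= 1/2 it reduces to y <= 2 y^2; otherwise
    exp y <= 1 / (1 - y) <= 1 + y + 2 y^2. *)
Lemma expR_le_id_add (y : R) : expR y <= y + expR (2 * y ^+ 2).
Proof.
have e1 := expR_ge1Dx (2 * y ^+ 2).
have [yh|yh] := leP (1 / 2) y.
  rewrite -[leLHS]add0r lerD //; first by lra.
  by rewrite ler_expR; nra.
have y1 : 0 < 1 - y by lra.
have /= e2 := expR_ge1Dx (- y).
have : expR y <= (1 - y)^-1.
  by rewrite -[expR y]invrK -expRN lef_pV2 ?posrE ?expR_gt0.
have : (1 - y)^-1 <= 1 + y + 2 * y ^+ 2.
  rewrite -[_^-1]mul1r ler_pdivrMr //.
  have : 0 <= y ^+ 2 * (1 - 2 * y) by rewrite mulr_ge0 ?sqr_ge0 //; lra.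
  nra.
lra.
Qed.

(** The bound depends on [v] through its Euclidean norm only, hence not on the
    number [r] of labels, because a label noise has squared norm at most 2. *)
Lemma label_noise_mgf i (v : 'cV[R]_r) :
  \sum_a s a i * expR (mxdot v (label_noise i a) / 16) <= expR (mxsqnorm v / 64).
Proof.
pose y a := mxdot v (label_noise i a) / 16.
have mean0 : \sum_a s a i * y a = 0.
  transitivity (mxdot v (\sum_a s a i *: label_noise i a) / 16).
    rewrite [in RHS](big_morph (mxdot v) (mxdotDr v) (_ : mxdot v 0 = 0)).
      rewrite mulr_suml; apply: eq_bigr => a _.
      by rewrite mxdotZr mulrA.
    by rewrite mxdot0r.
  by rewrite label_noise_mean mxdot0r mul0r.
apply: (@le_trans _ _ (\sum_a (s a i * y a + s a i * expR (mxsqnorm v / 64)))).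
  apply: ler_sum => a _; rewrite -mulrDr ler_wpM2l // (le_trans (expR_le_id_add _)) //.
  rewrite lerD2l ler_expR.
  by have := mxdot_sqr_le v (label_noise_sqnorm_le2 i a); lra.
by rewrite big_split /= mean0 -mulr_suml s_sum1 mul1r add0r.
Qed.

End ProductExpectation.

Section QuadraticNoise.
Variables (R : realType) (r n : nat) (s : 'M[R]_(r.+1, n)).
Hypothesis s_ge0 : forall a i, 0 <= s a i.
Hypothesis s_sum1 : forall i, \sum_a s a i = 1.

(** Splitting off column [i], of squared norm at most 2, the form is the one of the
    remaining columns, plus a diagonal term bounded outright, plus a cross term
    handled by [label_noise_mgf]. *)
Lemma quad_noise_step i (A : 'M[R]_n) f : contraction r.+1 A ->
  \sum_a s a i * expR (quad A (noise s (relabel f i a)) / 32) <=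
  expR (A i i / 16) * expR (quad (integrate_out i A) (noise s f) / 32).
Proof.
move=> cA; have A0 := contraction_diag_ge0 i cA; have [As _] := cA.
rewrite quad_integrate_out; set y := _ *m erase R i; set v := y *m col i A.
apply: (@le_trans _ _ (expR (A i i / 16 + quad A y / 32) *
   \sum_a s a i * expR (mxdot v (label_noise s i a) / 16))).
  rewrite mulr_sumr; apply: ler_sum => a _.
  rewrite mulrCA ler_wpM2l // -expRD ler_expR noise_relabel quad_split // -/v.
  have := ler_wpM2l A0 (label_noise_sqnorm_le2 s_ge0 s_sum1 i a); lra.
have := label_noise_mgf s_ge0 s_sum1 i v.
move=> /(ler_wpM2l (expR_ge0 (A i i / 16 + quad A y / 32))) /le_trans; apply.
by rewrite -!expRD ler_expR; lra.
Qed.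

(** Induction on a list [l] of the columns that [A] still charges: each step
    erases one column and pays for it with the trace. *)
Lemma quad_noise_mgf_seq (l : seq 'I_n) (A : 'M[R]_n) : contraction r.+1 A ->
  (forall k, k \notin l -> col k A = 0) ->
  prodE s (fun f => expR (quad A (noise s f) / 32)) <= expR (\tr A / 8).
Proof.
elim: l A => [|i l IH] A cA Al.
  have -> : A = 0.
    apply/matrixP => a k; have /colP/(_ a) := Al k isT.
    by rewrite !mxE.
  rewrite mxtrace0 mul0r expR0 -[leRHS](prodE_cst s_sum1 1).
  apply: prodE_le => // f.
  by rewrite /quad mulmx0 mxdot0l mul0r expR0.
have [As _] := cA.
rewrite (prodE_relabel s_sum1 i).
have := prodE_le s_ge0 (fun f => quad_noise_step i f cA) => /le_trans; apply.
rewrite prodEZ.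
have {}IH : prodE s (fun f => expR (quad (integrate_out i A) (noise s f) / 32))
    <= expR (\tr (integrate_out i A) / 8).
  apply: IH => [|k kl]; first exact: contraction_integrate_out.
  have [->|ki] := eqVneq k i; first exact: col0_integrate_out.
  by apply: col_integrate_out => //; apply: Al; rewrite inE negb_or ki.
apply: (le_trans (ler_wpM2l (expR_ge0 _) IH)).
by rewrite -expRD ler_expR; have := trace_integrate_out i cA; lra.
Qed.

Lemma quad_noise_mgf (A : 'M[R]_n) : contraction r.+1 A ->
  prodE s (fun f => expR (quad A (noise s f) / 32)) <= expR (\tr A / 8).
Proof.
move=> cA; apply: (quad_noise_mgf_seq (l := enum 'I_n)) => // k.
by rewrite mem_enum.
Qed.

(** Redrawing label [k] alone shows that distinct columns are uncorrelated. *)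
Lemma noise_cov a k l :
  prodE s (fun f => noise s f a k * noise s f a l) =
  (k == l)%:R * (s a k - s a k ^+ 2).
Proof.
rewrite (prodE_relabel s_sum1 k).
have [<-|kl] := eqVneq k l.
  rewrite -[RHS](prodE_cst s_sum1); apply: eq_prodE => f.
  under eq_bigr => b _ do rewrite !mxE !ffunE eqxx.
  rewrite (eq_bigr (fun b => (b == a)%:R * (s b k * (1 - 2 * s a k)) + s b k * s a k ^+ 2)).
    rewrite big_split /= -mulr_suml s_sum1 (bigD1 a) //= eqxx big1 ?addr0 ?mulr1n; first by ring.
    by move=> b /negbTE ->; rewrite mul0r.
  by move=> b _; case: (b == a) => /=; ring.
rewrite mul0r -[RHS](prodE_cst s_sum1); apply: eq_prodE => f.
under eq_bigr => b _ do rewrite !mxE !ffunE eqxx (eq_sym l) (negbTE kl) mulrA.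
rewrite -mulr_suml (_ : \sum_b _ = 0) ?mul0r //.
have /colP/(_ a) := label_noise_mean s_sum1 k.
rewrite summxE [in RHS]mxE => mean0; rewrite -[RHS]mean0.
by apply: eq_bigr => b _; rewrite !mxE.
Qed.

Lemma quad_noise_mean (A : 'M[R]_n) :
  prodE s (fun f => quad A (noise s f)) =
  \sum_i A i i * (1 - \sum_a s a i ^+ 2).
Proof.
transitivity (prodE s (fun f => \sum_a \sum_l \sum_k
    A k l * (noise s f a k * noise s f a l))).
  apply: eq_prodE => f; apply: eq_bigr => a _; apply: eq_bigr => l _.
  by rewrite mxE mulr_suml; apply: eq_bigr => k _; rewrite mulrAC mulrC.
rewrite prodE_sum.
under eq_bigr => a _ do rewrite prodE_sum.
rewrite exchange_big; apply: eq_bigr => l _ /=.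
rewrite -[in RHS](s_sum1 l) -sumrB mulr_sumr; apply: eq_bigr => a _.
rewrite prodE_sum (bigD1 l) //= prodEZ noise_cov eqxx mul1r big1 ?addr0 // => k kl.
by rewrite prodEZ noise_cov (negbTE kl) mul0r mulr0.
Qed.

Lemma quad_noise_mean_le (A : 'M[R]_n) : contraction r.+1 A ->
  prodE s (fun f => quad A (noise s f)) <= \tr A.
Proof.
move=> cA; rewrite quad_noise_mean; apply: ler_sum => i _.
rewrite ler_piMr ?(contraction_diag_ge0 i cA) // gerBl.
by apply: sumr_ge0 => a _; exact: sqr_ge0.
Qed.

(** This is where the bound on [s] enters: it prevents the columns of the noise
    from degenerating, since sum_a (s a i)^2 <= max_a (s a i). *)
Lemma quad_noise_mean_ge (A : 'M[R]_n) (rho : R) : contraction r.+1 A ->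
  (forall a i, s a i <= 1 - rho) ->
  rho * \tr A <= prodE s (fun f => quad A (noise s f)).
Proof.
move=> cA srho; rewrite quad_noise_mean mulr_sumr; apply: ler_sum => i _.
rewrite mulrC ler_wpM2l ?(contraction_diag_ge0 i cA) //.
suff : \sum_a s a i ^+ 2 <= 1 - rho by lra.
have -> : 1 - rho = (1 - rho) * \sum_a s a i by rewrite s_sum1 mulr1.
rewrite mulr_sumr; apply: ler_sum => a _.
by rewrite expr2; apply: ler_wpM2r.
Qed.

End QuadraticNoise.

(** * Projections on the span of an orthonormal family *)

Section OrthonormalFamily.
Variables (R : realType) (n : nat) (I : finType) (phi : I -> 'rV[R]_n).
Hypothesis phi_on : forall l l', phi l *m (phi l')^T = (l == l')%:R%:M.
Implicit Types m : {set I}.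

Definition span_of m : {vspace 'rV[R]_n} := <<[seq phi l | l <- enum m]>>%VS.

Definition proj_mx m : 'M[R]_n := \sum_(l in m) (phi l)^T *m phi l.

(** A linear identity is checked on generators; it is applied both to inner
    products and to the equation v *m proj_mx m = v. *)
Lemma span_mulmx0 p (X : seq 'rV[R]_n) (B : 'M[R]_(n, p)) v :
  (forall x, x \in X -> x *m B = 0) -> v \in <<X>>%VS -> v *m B = 0.
Proof.
move=> XB /(@coord_span _ _ _ (in_tuple X)) ->.
rewrite mulmx_suml big1 // => i _.
by rewrite -scalemxAl XB ?scaler0 // mem_nth.
Qed.

Lemma dim_span_of m : \dim (span_of m) = #|m|.
Proof.
suff fr ls : uniq ls -> free [seq phi l | l <- ls].
  by have /eqP -> := fr _ (enum_uniq m); rewrite size_map -cardE.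
elim: ls => [_|l ls IH /=/andP[lls uls]]; first exact: nil_free.
rewrite free_cons IH // andbT; apply/negP => lspan.
have : phi l *m (phi l)^T = 0.
  apply: span_mulmx0 lspan => x /mapP[k kls ->].
  rewrite phi_on; case: eqP => [kl|_]; last by rewrite raddf0.
  by rewrite -kl kls in lls.
move=> /matrixP/(_ 0 0)/eqP; rewrite phi_on !mxE !eqxx mulr1n.
by rewrite oner_eq0.
Qed.

Lemma tr_proj_mx m : (proj_mx m)^T = proj_mx m.
Proof.
rewrite [LHS]raddf_sum; apply: eq_bigr => l _ /=.
by rewrite trmx_mul trmxK.
Qed.

Lemma phi_proj_mx m l : phi l *m proj_mx m = (l \in m)%:R *: phi l.
Proof.
rewrite mulmx_sumr; under eq_bigr => k _ do rewrite mulmxA phi_on mul_scalar_mx.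
have [lm|lm] := boolP (l \in m).
  rewrite (bigD1 l) //= eqxx big1 ?addr0 // => k /andP[_].
  by rewrite eq_sym => /negbTE ->; rewrite scale0r.
rewrite scale0r big1 // => k km; case: eqP => [lk|_]; last by rewrite scale0r.
by rewrite lk km in lm.
Qed.

Lemma proj_mx_sub m1 m2 : m1 \subset m2 -> proj_mx m1 *m proj_mx m2 = proj_mx m1.
Proof.
move=> /fintype.subsetP sub; rewrite mulmx_suml; apply: eq_bigr => l lm.
by rewrite -mulmxA phi_proj_mx sub // scale1r.
Qed.

Lemma proj_mx_idem m : proj_mx m *m proj_mx m = proj_mx m.
Proof. exact: proj_mx_sub. Qed.

Lemma trace_proj_mx m : \tr (proj_mx m) = #|m|%:R.
Proof.
rewrite raddf_sum /= (eq_bigr (fun=> 1)) => [|l _].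
  by rewrite sumr_const.
by rewrite mxtrace_mulC phi_on eqxx mxtrace1.
Qed.

Lemma quad_proj_mx r m (t : 'M[R]_(r, n)) :
  quad (proj_mx m) t = mxsqnorm (t *m proj_mx m).
Proof.
by rewrite /quad -[in LHS]proj_mx_idem mulmxA mxdot_adjoint tr_proj_mx.
Qed.

Lemma quad_proj_mx_sum r m (t : 'M[R]_(r, n)) :
  quad (proj_mx m) t = \sum_(l in m) mxsqnorm (t *m (phi l)^T).
Proof.
rewrite /quad mulmx_sumr.
rewrite (big_morph (fun x => mxdot x t) (fun x y => mxdotDl x y t) (_ : mxdot 0 t = 0)) /=.
  by apply: eq_bigr => l _; rewrite mulmxA mxdot_adjoint.
exact: mxdot0l.
Qed.

Lemma quad_proj_mxU r m1 m2 (t : 'M[R]_(r, n)) :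
  quad (proj_mx (m1 :|: m2)) t <= quad (proj_mx m1) t + quad (proj_mx m2) t.
Proof.
rewrite !quad_proj_mx_sum big_mkcond [X in _ <= X + _]big_mkcond.
rewrite [X in _ <= _ + X]big_mkcond -big_split; apply: ler_sum => l _ /=.
have := mxsqnorm_ge0 (t *m (phi l)^T); rewrite inE.
by case: (l \in m1); case: (l \in m2) => /=; lra.
Qed.

Lemma pythagoras_proj_mx r m (t : 'M[R]_(r, n)) :
  mxsqnorm t = mxsqnorm (t - t *m proj_mx m) + mxsqnorm (t *m proj_mx m).
Proof.
rewrite /mxsqnorm !mxdot_linear (mxdotC t (_ *m _)).
have -> : mxdot (t *m proj_mx m) (t *m proj_mx m) = mxdot (t *m proj_mx m) t.
  by rewrite -!/(mxsqnorm _) -quad_proj_mx.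
ring.
Qed.

Lemma contraction_proj_mx r m : contraction r (proj_mx m).
Proof.
split=> [|t]; first exact: tr_proj_mx.
rewrite quad_proj_mx mxsqnorm_ge0 /= [leRHS](pythagoras_proj_mx m).
by rewrite lerDr mxsqnorm_ge0.
Qed.

Lemma rows_in_span r m (t : 'M[R]_(r, n)) :
  rows_in (span_of m) t <-> t *m proj_mx m = t.
Proof.
split=> [tm|<- j].
  apply/row_matrixP => j; rewrite row_mul; apply/eqP.
  rewrite -subr_eq0 -[X in _ - X]mulmx1 -mulmxBr; apply/eqP.
  apply: span_mulmx0 (tm j) => x /mapP[l]; rewrite mem_enum => lm ->.
  by rewrite mulmxBr mulmx1 phi_proj_mx lm scale1r subrr.
rewrite row_mul mulmx_sumr; apply: rpred_sum => l lm.
rewrite mulmxA [_ *m _^T]mx11_scalar mul_scalar_mx rpredZ // memv_span //.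
by apply/mapP; exists l; rewrite ?mem_enum.
Qed.

(** The difference of two orthogonal projections of [x] lies in the space and is
    orthogonal to it. *)
Lemma orthoproj_proj_mx r m (x : 'M[R]_(r, n)) :
  orthoproj (span_of m) x = x *m proj_mx m.
Proof.
have xm : is_orthoproj (span_of m) x (x *m proj_mx m).
  split=> [|t /rows_in_span <-].
    by apply/rows_in_span; rewrite -mulmxA proj_mx_idem.
  by rewrite mxdotC mxdot_adjoint tr_proj_mx mulmxBl -mulmxA proj_mx_idem subrr mxdot0r.
have [pm pP] : is_orthoproj (span_of m) x (orthoproj (span_of m) x).
  apply: (@xgetPex _ 0 [set p | is_orthoproj (span_of m) x p]).
  by exists (x *m proj_mx m).
have [qm qP] := xm; apply/eqP; rewrite -subr_eq0; apply/eqP/mxsqnorm_eq0.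
set p := orthoproj _ _ in pm pP *.
have dm : rows_in (span_of m) (p - x *m proj_mx m).
  by apply/rows_in_span; rewrite mulmxBl; congr (_ - _); exact/rows_in_span.
have := qP _ dm; have := pP _ dm.
by rewrite /mxsqnorm !mxdot_linear; lra.
Qed.

End OrthonormalFamily.

(** * Orthonormality of the Haar vectors *)

Section HaarOrthonormal.
Variable R : realType.
Implicit Types h i q N : nat.

(** The wavelet at the dyadic block [k] of length 2 ^ h.+1, as a function of the
    index [i] counted from 0: its two halves are the blocks [k.*2] and [k.*2.+1]
    of length 2 ^ h. *)
Definition dyadic_sign h k i : R :=
  if (i %/ 2 ^ h == k.*2)%N then 1
  else if (i %/ 2 ^ h == k.*2.+1)%N then - 1 else 0.

Lemma divn_eqE i M q : (0 < M)%N -> (i %/ M == q)%N = (q * M <= i < q.+1 * M)%N.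
Proof. by move=> M0; rewrite -leq_divRL // -ltn_divLR // ltnS -eqn_leq eq_sym. Qed.

Lemma haar_waveletE j h k i :
  haar_wavelet (2 ^+ j * (i.+1%:R / (2 ^ (j + h.+1))%N%:R) - k%:R) =
  dyadic_sign h k i.
Proof.
set M := (2 ^ h)%N; have M0 : (0 < M)%N by rewrite expn_gt0.
have Mr : 0 < M%:R :> R by rewrite ltr0n.
pose y : R := i.+1%:R - k%:R * (2 * M%:R).
have -> : 2 ^+ j * (i.+1%:R / (2 ^ (j + h.+1))%N%:R) - k%:R = y / (2 * M%:R) :> R.
  rewrite expnD expnS !natrM -/M natrX /y.
  have j0 : (2 : R) ^+ j != 0 by rewrite expf_neq0 // pnatr_eq0.
  by field; rewrite j0 gt_eqF.
have M2 : 0 < 2 * M%:R :> R by lra.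
have le1 (z : R) : (y / (2 * M%:R) <= z) = (y <= z * (2 * M%:R)) by rewrite ler_pdivrMr.
have lt1 (z : R) : (z < y / (2 * M%:R)) = (z * (2 * M%:R) < y) by rewrite ltr_pdivlMr.
rewrite /haar_wavelet /dyadic_sign !le1 !lt1 !divn_eqE //.
have -> : (0 * (2 * M%:R) < y) = (k.*2 * M <= i)%N.
  rewrite mul0r subr_gt0 -!natrM ltr_nat ltnS mulnA muln2; lia.
have e (z : R) q : z * (2 * M%:R) = q%:R - k%:R * (2 * M%:R) ->
   (y <= z * (2 * M%:R)) = (i < q)%N.
  by move=> ->; rewrite lerD2r ler_nat.
have e' (z : R) q : z * (2 * M%:R) = q%:R - k%:R * (2 * M%:R) ->
   (z * (2 * M%:R) < y) = (q <= i)%N.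
  by move=> ->; rewrite ltrD2r ltr_nat ltnS.
rewrite (e _ (k.*2.+1 * M)%N); last by rewrite natrM -[k.*2.+1]addn1 natrD -mul2n natrM; field.
rewrite (e' _ (k.*2.+1 * M)%N); last by rewrite natrM -[k.*2.+1]addn1 natrD -mul2n natrM; field.
rewrite (e _ (k.*2.+2 * M)%N) //.
by rewrite natrM -[k.*2.+2]addn2 natrD -mul2n natrM; ring.
Qed.

(** Flipping the binary digit of weight 2 ^ h exchanges the two halves of every
    dyadic block of length 2 ^ h.+1, and preserves every longer dyadic block. *)
Definition flip_bit h i : nat :=
  let q := (i %/ 2 ^ h)%N in
  ((if odd q then q.-1 else q.+1) * 2 ^ h + i %% 2 ^ h)%N.

Lemma flip_bit_div h i : (flip_bit h i %/ 2 ^ h =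
  if odd (i %/ 2 ^ h) then (i %/ 2 ^ h).-1 else (i %/ 2 ^ h).+1)%N.
Proof.
have small : (i %% 2 ^ h < 2 ^ h)%N by rewrite ltn_mod expn_gt0.
by rewrite /flip_bit divnMDl ?expn_gt0 // (divn_small small) addn0.
Qed.

Lemma flip_bit_div_gt h h' i : (h < h')%N -> (flip_bit h i %/ 2 ^ h' = i %/ 2 ^ h')%N.
Proof.
move=> hh; rewrite -(subnK hh) addnC expnD expnSr -mulnA !divnMA flip_bit_div.
set q := (i %/ 2 ^ h)%N; congr (_ %/ _)%N; case: ifP => oq; lia.
Qed.

Lemma flip_bitK h : involutive (flip_bit h).
Proof.
move=> i; rewrite {1}/flip_bit flip_bit_div /flip_bit modnMDl modn_mod.
rewrite [RHS](divn_eq i (2 ^ h)); congr (_ * _ + _)%N.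
set q := (i %/ 2 ^ h)%N; case oq: (odd q); last by rewrite /= oq.
by case: q oq => //= q /negbTE ->.
Qed.

Lemma flip_bit_lt h N i : (h < N)%N -> (i < 2 ^ N)%N -> (flip_bit h i < 2 ^ N)%N.
Proof.
move=> hN iN; rewrite -[ltnRHS]mul1n -ltn_divLR ?expn_gt0 //.
by rewrite flip_bit_div_gt // divn_small.
Qed.

Lemma dyadic_sign_flip h k i : dyadic_sign h k (flip_bit h i) = - dyadic_sign h k i.
Proof.
rewrite /dyadic_sign flip_bit_div; set q := (i %/ _)%N.
have [->|q1] := eqVneq q k.*2; first by rewrite odd_double eqxx (gtn_eqF (ltnSn _)).
have [->|q2] := eqVneq q k.*2.+1; first by rewrite /= odd_double /= eqxx opprK.
rewrite oppr0; case oq: (odd q).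
  by rewrite ifN; [rewrite ifN //; lia | lia].
by rewrite ifN; [rewrite ifN //; lia | lia].
Qed.

Lemma dyadic_sign_flip_coarse h h' k i : (h < h')%N ->
  dyadic_sign h' k (flip_bit h i) = dyadic_sign h' k i.
Proof. by move=> hh; rewrite /dyadic_sign flip_bit_div_gt. Qed.

Lemma sum_flip N h (F : 'I_(2 ^ N) -> R) : (h < N)%N ->
  (forall i i' : 'I_(2 ^ N), i' = flip_bit h i :> nat -> F i' = - F i) ->
  \sum_i F i = 0.
Proof.
move=> hN Fh; pose fl (i : 'I_(2 ^ N)) := Ordinal (flip_bit_lt hN (ltn_ord i)).
have flK : involutive fl by move=> i; apply: val_inj; rewrite /= flip_bitK.
have : \sum_i F i = - \sum_i F i.
  rewrite [LHS](reindex_inj (inv_inj flK)) -sumrN.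
  by apply: eq_bigr => i _; exact: Fh.
lra.
Qed.

Lemma dyadic_sign_mul h k k' i : k != k' ->
  dyadic_sign h k i * dyadic_sign h k' i = 0.
Proof.
move=> kk; rewrite /dyadic_sign; set q := (i %/ _)%N.
case: (q =P k.*2) => ?; case: (q =P k.*2.+1) => ?; case: (q =P k'.*2) => ?;
  case: (q =P k'.*2.+1) => ?; rewrite ?mulr0 ?mul0r //; lia.
Qed.

Lemma sum_dyadic_sign_sqr j h k : (k < 2 ^ j)%N ->
  \sum_(i < 2 ^ (j + h.+1)) dyadic_sign h k i ^+ 2 = (2 ^ h.+1)%:R.
Proof.
move=> kj; set M := (2 ^ h.+1)%N; have M0 : (0 < M)%N by rewrite expn_gt0.
have sq i : dyadic_sign h k i ^+ 2 = (i %/ M == k)%N%:R.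
  rewrite /M expnSr divnMA /dyadic_sign; set q := (i %/ 2 ^ h)%N.
  have [->|q1] := eqVneq q k.*2; first by rewrite expr1n (_ : _ == k)%N //; lia.
  have [->|q2] := eqVneq q k.*2.+1; first by rewrite sqrrN expr1n (_ : _ == k)%N //; lia.
  by rewrite expr0n /= (_ : (_ == k)%N = false) //; lia.
rewrite -(big_mkord xpredT (fun i => dyadic_sign h k i ^+ 2)) expnD -/M big_nat_mul.
rewrite big_mkord (bigD1 (Ordinal kj)) //= [X in _ + X]big1 ?addr0.
  rewrite (eq_big_nat _ _ (F2 := fun=> 1)) => [|i iM]; last first.
    by rewrite sq divn_eqE // iM.
  by rewrite big_const_nat iter_addr addr0 mulSn addnK.
move=> q qk; rewrite big_nat big1 // => i iM; rewrite sq.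
by move: iM; rewrite -divn_eqE // => /eqP ->; rewrite (_ : (_ == k) = false) //; apply/negbTE.
Qed.

Definition haar_coef N j : R := 2 `^ (j%:R / 2) / Num.sqrt (2 ^ N)%N%:R.

Lemma haar_vecE N (j : 'I_N) (k : 'I_(2 ^ j)) (i : 'I_(2 ^ N)) :
  haar_vec R (Some (existT _ j k) : haar_index N) 0 i =
  haar_coef N j * dyadic_sign (N - j.+1) k i.
Proof.
rewrite /haar_vec mxE -(haar_waveletE j) /haar_coef.
by rewrite (_ : (j + (N - j.+1).+1)%N = N) //; have := ltn_ord j; lia.
Qed.

Lemma haar_coef_sqr N j : haar_coef N j ^+ 2 = 2 ^+ j / (2 ^ N)%N%:R.
Proof.
rewrite exprMn exprVn sqr_sqrtr ?ler0n // -powR_mulrn ?powR_ge0 //.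
by rewrite -powRrM divfK ?pnatr_eq0 // powR_mulrn // ler0n.
Qed.

Lemma haar_flip_fine N (j : 'I_N) (k : 'I_(2 ^ j)) (i i' : 'I_(2 ^ N)) :
  i' = flip_bit (N - j.+1) i :> nat ->
  haar_vec R (Some (existT _ j k) : haar_index N) 0 i' =
  - haar_vec R (Some (existT _ j k) : haar_index N) 0 i.
Proof. by move=> ii'; rewrite !haar_vecE ii' dyadic_sign_flip mulrN. Qed.

Lemma haar_flip_coarse N (l : haar_index N) (j : 'I_N) (i i' : 'I_(2 ^ N)) :
  haar_scale l < (j : nat)%:Z -> i' = flip_bit (N - j.+1) i :> nat ->
  haar_vec R l 0 i' = haar_vec R l 0 i.
Proof.
case: l => [[j' k']|] /= lt_j ii'; last by rewrite !mxE.
rewrite !haar_vecE ii' dyadic_sign_flip_coarse //.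
by rewrite ltz_nat in lt_j; have := ltn_ord j; lia.
Qed.

(** The flip that exchanges the halves of the finer wavelet reverses its sign and
    does not affect the coarser one, so the inner product equals its opposite. *)
Lemma haar_orthogonal_levels N (l l' : haar_index N) :
  haar_scale l < haar_scale l' -> mxdot (haar_vec R l) (haar_vec R l') = 0.
Proof.
case: l' => [[j k]|] lt_l; last by case: l lt_l => [[]|].
rewrite /mxdot big_ord1; have hN : (N - j.+1 < N)%N by have := ltn_ord j; lia.
apply: (sum_flip hN) => i i' ii'.
by rewrite (haar_flip_coarse lt_l ii') (haar_flip_fine _ ii') mulrN.
Qed.

Lemma haar_orthonormal N (l l' : haar_index N) :
  haar_vec R l *m (haar_vec R l')^T = (l == l')%:R%:M.
Proof.
suff dotE : mxdot (haar_vec R l) (haar_vec R l') = (l == l')%:R.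
  by rewrite [LHS]mx11_scalar -dotE mxdotE /mxtrace big_ord1.
have [lt_ll'|lt_l'l|] := ltgtP (haar_scale l) (haar_scale l').
- by rewrite haar_orthogonal_levels //; case: eqP lt_ll' => // ->; rewrite ltxx.
- by rewrite mxdotC haar_orthogonal_levels //; case: eqP lt_l'l => // ->; rewrite ltxx.
case: l l' => [[j k]|] [[j' k']|] //=; last first.
  move=> _; rewrite /mxdot big_ord1 (eq_bigr (fun=> (2 ^ N)%N%:R^-1)) => [|i _].
    by rewrite sumr_const card_ord -[_ *+ _]mulr_natr mulVf // pnatr_eq0 expn_eq0.
  by rewrite !mxE -expr2 exprMn expr1n mul1r exprVn sqr_sqrtr ?ler0n.
move=> [/val_inj jj]; case: _ / jj k' => k' {j'}.
rewrite /mxdot big_ord1 (eq_bigr (fun i : 'I_(2 ^ N) => haar_coef N j ^+ 2 *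
   (dyadic_sign (N - j.+1) k i * dyadic_sign (N - j.+1) k' i))) => [|i _]; last first.
  by rewrite !haar_vecE; ring.
rewrite -mulr_sumr.
have [kk'|kk'] := eqVneq k k'.
  rewrite -kk' eqxx haar_coef_sqr.
  have -> : \sum_(i < 2 ^ N) dyadic_sign (N - j.+1) k i * dyadic_sign (N - j.+1) k i =
      (2 ^ (N - j.+1).+1)%:R.
    rewrite -(sum_dyadic_sign_sqr (N - j.+1) (ltn_ord k)).
    by rewrite (_ : (j + (N - j.+1).+1)%N = N) //; have := ltn_ord j; lia.
  rewrite mulrAC -natrX -natrM -expnD.
  rewrite (_ : (j + (N - j.+1).+1)%N = N); last by have := ltn_ord j; lia.
  by rewrite mulfV // pnatr_eq0 expn_eq0.
rewrite big1 ?mulr0 => [|i _]; last exact: dyadic_sign_mul.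
case: eqP => // -[] /eqP; rewrite eq_Tagged /= => /eqP kk.
by rewrite kk eqxx in kk'.
Qed.

End HaarOrthonormal.

(** * Counting the models *)

Section Kraft.
Variable R : realType.
Implicit Types N J : nat.

(** The scale shifted by one, a natural number that is 0 at the constant vector. *)
Definition depth N (l : haar_index N) : nat :=
  if l is Some jk then (tag jk).+1 else 0.

Lemma in_haar_level N j (l : haar_index N) :
  (l \in haar_level N (j : nat)%:Z) = (depth l == j.+1).
Proof. by rewrite inE; case: l => [[i k]|]. Qed.

Lemma depth_le N (l : haar_index N) : (depth l <= N)%N.
Proof. by case: l => [[i k]|] //=; exact: ltn_ord. Qed.

Lemma card_haar_level N j : (j < N)%N -> #|haar_level N (j : nat)%:Z| = (2 ^ j)%N.
Proof.
move=> jN; pose f (k : 'I_(2 ^ j)) : haar_index N :=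
  Some (existT (fun i : 'I_N => 'I_(2 ^ i)) (Ordinal jN) k).
have fI : injective f.
  by move=> k k' /Some_inj/eqP; rewrite eq_Tagged => /eqP.
rewrite -(card_ord (2 ^ j)) -cardsT -(card_imset _ fI); apply: eq_card => l.
rewrite in_haar_level; apply/eqP/imsetP => [|[k _ ->] //].
case: l => [[i k]|] //= [ij].
have {}ij : i = Ordinal jN by exact: val_inj.
by subst i; exists k.
Qed.

Lemma card_coarse N J : (J <= N)%N -> #|[set l : haar_index N | (depth l <= J)%N]%SET| = (2 ^ J)%N.
Proof.
elim: J => [_|J IH JN].
  rewrite (_ : [set _ | _]%SET = [set None]%SET) ?cards1 //.
  by apply/setP => -[[i k]|]; rewrite !inE.
have -> : ([set l : haar_index N | (depth l <= J.+1)%N] =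
    [set l | (depth l <= J)%N] :|: haar_level N (J : nat)%:Z)%SET.
  by apply/setP => l; rewrite finset.in_setU in_haar_level !inE leq_eqVlt orbC ltnS.
rewrite cardsU IH ?(ltnW JN) // card_haar_level // (_ : _ :&: _ = finset.set0)%SET.
  by rewrite cards0 subn0 addnn -mul2n expnS.
apply/setP => l; rewrite finset.in_setI in_haar_level !inE.
by case: eqP => [->|_]; rewrite ?ltnn ?andbF.
Qed.

Lemma sum_by_level N J (g : haar_index N -> R) : (J <= N)%N ->
  \sum_(l | (J < depth l)%N) g l =
  \sum_(k < N - J) \sum_(l in haar_level N (J + k)%N%:Z) g l.
Proof.
move=> JN; under [RHS]eq_bigr => k _ do rewrite big_mkcond.
rewrite exchange_big [LHS]big_mkcond; apply: eq_bigr => l _ /=.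
have dN := depth_le l; case: ifP => Jd.
  have kP : (depth l - J.+1 < N - J)%N by lia.
  rewrite (bigD1 (Ordinal kP)) //= in_haar_level ifT; last by lia.
  rewrite big1 ?addr0 // => k kk; rewrite in_haar_level ifN //.
  by apply: contraNN kk => /eqP dk; apply/eqP/val_inj => /=; lia.
by rewrite big1 // => k _; rewrite in_haar_level ifN //; lia.
Qed.

Lemma expN3_le : expR (- 3) <= 1 / 4 :> R.
Proof.
rewrite expRN -[leRHS]invrK lef_pV2 ?posrE ?expR_gt0 //.
by have := expR_ge1Dx (3 : R); lra.
Qed.

Lemma sum_geo_half n : \sum_(k < n) 2^-1 ^+ k <= 2 :> R.
Proof.
suff -> : \sum_(k < n) 2^-1 ^+ k = 2 - 2 * 2^-1 ^+ n :> R.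
  by rewrite lerBlDr lerDl mulr_ge0 // exprn_ge0.
elim: n => [|n IH]; first by rewrite big_ord0 expr0; ring.
by rewrite big_ord_recr /= IH exprS; field.
Qed.

(** The size of the slices decays fast enough for their total depth to be
    comparable to 2 ^ J: the sum telescopes, since
    k / (k + 1)^3 <= 1 / (k + 1) - 1 / (k + 2). *)
Lemma sum_slice_depth J n :
  (\sum_(k < n) k * (2 ^ J %/ k.+1 ^ 3) <= 2 ^ J)%N.
Proof.
suff : (\sum_(k < n) k * (2 ^ J %/ k.+1 ^ 3))%:R <= (2 ^ J)%:R * (1 - n.+1%:R^-1) :> R.
  move=> /le_trans h; rewrite -(ler_nat R); apply: h.
  by rewrite ler_piMr ?ler0n // gerBl invr_ge0.
elim: n => [|n IH]; first by rewrite big_ord0 invr1 subrr mulr0.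
rewrite big_ord_recr /= natrD (le_trans (lerD IH (lexx _))) //.
rewrite -lerBrDl -mulrBr natrM.
set x : R := n%:R; have x0 : 0 <= x by rewrite ler0n.
have q_le : (2 ^ J %/ n.+1 ^ 3)%N%:R <= (2 ^ J)%N%:R / (x + 1) ^+ 3 :> R.
  rewrite ler_pdivlMr ?exprn_gt0 //; last by lra.
  by rewrite /x natr1 -natrX -natrM ler_nat leq_divM.
have := ler_wpM2l x0 q_le => /le_trans; apply.
rewrite mulrCA ler_wpM2l // -(natr1 n.+1) -(natr1 n) -/x.
rewrite -subr_ge0.
have -> : 1 - (x + 1 + 1)^-1 - (1 - (x + 1)^-1) - x / (x + 1) ^+ 3 =
   ((x + 1 + 1) * (x + 1) ^+ 3)^-1.
  by field; apply/andP; split; lra.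
by rewrite invr_ge0 mulr_ge0 ?exprn_ge0 //; lra.
Qed.

Section Slice.
Variables (N J : nat).
Hypothesis JN : (J < N)%N.

Lemma slice_coarse m (l : haar_index N) : neh_slice J m -> (depth l <= J)%N -> l \in m.
Proof.
move=> [L' [_ ->]] dl; rewrite finset.in_setU; apply/orP; left; rewrite finset.in_setU.
case: l dl => [[j k]|] /= dl; last by rewrite inE.
apply/orP; right; apply/finset.bigcupP; exists (Ordinal dl) => //.
by rewrite in_haar_level.
Qed.

Lemma slice_card_ge (m : {set haar_index N}) : neh_slice J m -> (2 ^ J <= #|m|)%N.
Proof.
move=> mJ; rewrite -(card_coarse (ltnW JN)); apply/subset_leq_card/fintype.subsetP => l.
by rewrite inE; exact: slice_coarse.
Qed.

Lemma slice_level_card (m : {set haar_index N}) (k : 'I_(N - J)) : neh_slice J m ->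
  (#|m :&: haar_level N (J + k)%N%:Z| <= 2 ^ J %/ k.+1 ^ 3)%N.
Proof.
move=> [L' [L'P ->]]; have [_ <-] := L'P k.
apply/subset_leq_card/fintype.subsetP => l; rewrite finset.in_setI in_haar_level.
move=> /andP[+ /eqP dl].
rewrite finset.in_setU => /orP[|/finset.bigcupP[k' _ lk']].
  rewrite finset.in_setU => /orP[|/finset.bigcupP[j _]].
    by rewrite inE; case: l dl => [[]|].
  by rewrite in_haar_level dl; have := ltn_ord j; lia.
have [/fintype.subsetP/(_ l lk') + _] := L'P k'.
rewrite in_haar_level dl => /eqP[/eqP]; rewrite eqn_add2l => /eqP/val_inj kk'.
by rewrite kk'.
Qed.

(** The odds of a fine wavelet in the product measure on subsets that is used to
    count the models: 1 at level [J], and exp (- 3) times smaller at each next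
    level. They are small enough for the measure to have mass exp (O (2 ^ J)),
    although level J + k has 2 ^ (J + k) elements, and large enough for each
    model to have weight at least exp (- O (2 ^ J)). *)
Definition fine_weight (l : haar_index N) : R := expR (- 3) ^+ (depth l - J.+1).

(** The product measure itself, not normalized. Subsets that miss a coarse wavelet
    have weight 0. *)
Definition model_weight (m : {set haar_index N}) : R :=
  \prod_l if l \in m then (if (J < depth l)%N then fine_weight l else 1)
          else (J < depth l)%N%:R.

Lemma fine_weight_ge0 l : 0 <= fine_weight l.
Proof. by rewrite exprn_ge0 // expR_ge0. Qed.

Lemma model_weight_ge0 m : 0 <= model_weight m.
Proof.
apply: prodr_ge0 => l _; case: ifP => _; last exact: ler0n.
by case: ifP => // _; exact: fine_weight_ge0.
Qed.

(** Expanding the product of the sums (weight in + weight out) over all the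
    wavelets gives the total mass, and 1 + x <= exp x bounds it. *)
Lemma sum_model_weight : \sum_m model_weight m <= expR (2 * (2 ^ J)%:R).
Proof.
rewrite /model_weight -(bigA_distr _ _ (fun l => if (J < depth l)%N then fine_weight l else 1)
  (fun l => (J < depth l)%N%:R)).
apply: (@le_trans _ _ (expR (\sum_(l | (J < depth l)%N) fine_weight l))).
  rewrite expR_sum [leRHS]big_mkcond; apply: ler_prod => l _.
  case: ifP => _ /=; last by rewrite addr0 ler01 lexx.
  by rewrite addr_ge0 ?fine_weight_ge0 //= addrC expR_ge1Dx.
rewrite ler_expR sum_by_level ?(ltnW JN) //.
apply: (@le_trans _ _ (\sum_(k < N - J) (2 ^ J)%:R * 2^-1 ^+ k)).
  apply: ler_sum => k _.
  rewrite (eq_bigr (fun=> expR (- 3) ^+ k)) => [|l]; last first.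
    by rewrite in_haar_level /fine_weight => /eqP ->; congr (_ ^+ _); lia.
  rewrite sumr_const card_haar_level; last by have := ltn_ord k; lia.
  rewrite -[_ *+ (2 ^ _)]mulr_natl expnD natrM -mulrA ler_wpM2l ?ler0n // natrX -exprMn.
  rewrite lerXn2r ?nnegrE ?mulr_ge0 ?expR_ge0 //.
  by have := expN3_le; lra.
by rewrite -mulr_sumr mulrC ler_wpM2r ?ler0n // sum_geo_half.
Qed.

(** The logarithm of the weight is - 3 times the total depth of the fine wavelets
    of the model beyond level [J]. *)
Lemma model_weight_slice m : neh_slice J m -> expR (- 3 * (2 ^ J)%:R) <= model_weight m.
Proof.
move=> mJ.
have -> : model_weight m =
    expR (\sum_(l | (J < depth l)%N) - 3 * ((l \in m) * (depth l - J.+1))%N%:R).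
  rewrite expR_sum [RHS]big_mkcond; apply: eq_bigr => l _.
  have [lm|lm] := boolP (l \in m).
    by case: ifP => // _; rewrite mul1n (mulrC (- 3)) expRM_natl.
  rewrite mul0n mulr0 expR0 ltnNge.
  by case: leqP => // /(slice_coarse mJ) lm'; rewrite lm' in lm.
rewrite ler_expR -mulr_sumr ler_nM2l ?ltrN0 //.
rewrite sum_by_level ?(ltnW JN) //.
under eq_bigr => k _ do rewrite -natr_sum.
rewrite -natr_sum ler_nat (leq_trans _ (sum_slice_depth J (N - J))) //.
apply: leq_sum => k _.
apply: (@leq_trans (k * #|m :&: haar_level N (J + k)%N%:Z|)); last first.
  by rewrite leq_mul2l slice_level_card ?orbT.
rewrite mulnC -sum_nat_const big_mkcond [X in (_ <= X)%N]big_mkcond.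
apply: leq_sum => l _; rewrite finset.in_setI in_haar_level.
case: eqP => [->|]; rewrite ?andbF // andbT.
by case: (l \in m); rewrite // mul1n; lia.
Qed.

(** The exponent 6 is spent as follows: 3 to exceed the inverse of the weight of a
    model, 2 for the total mass, and 1 for the convergence of the sum over
    [J]. *)
Lemma kraft_slice :
  \sum_(m : {set haar_index N} | `[< neh_slice J m >]) expR (- 6 * #|m|%:R) <=
  2^-1 ^+ J.+1 :> R.
Proof.
apply: (@le_trans _ _ (expR (- 3 * (2 ^ J)%:R) * \sum_m model_weight m)).
  rewrite mulr_sumr [leLHS]big_mkcond; apply: ler_sum => m _.
  case: ifP => [/asboolP mJ|_]; last by rewrite mulr_ge0 ?expR_ge0 ?model_weight_ge0.
  apply: (@le_trans _ _ (expR (- 3 * (2 ^ J)%:R) * expR (- 3 * (2 ^ J)%:R))).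
    rewrite -expRD ler_expR.
    have := slice_card_ge mJ; rewrite -(ler_nat R); lra.
  by rewrite ler_wpM2l ?expR_ge0 // model_weight_slice.
have := ler_wpM2l (expR_ge0 (- 3 * (2 ^ J)%:R)) sum_model_weight => /le_trans; apply.
have expN1 : expR (- 1) <= 2^-1 :> R.
  rewrite expRN lef_pV2 ?posrE ?expR_gt0 //.
  by have := expR_ge1Dx (1 : R); lra.
rewrite -expRD.
have -> : - 3 * (2 ^ J)%:R + 2 * (2 ^ J)%:R = (2 ^ J)%N%:R * (- 1) :> R by ring.
rewrite expRM_natl (@le_trans _ _ (2^-1 ^+ (2 ^ J))) //.
  by rewrite lerXn2r ?nnegrE ?expR_ge0.
by apply: ler_wiXn2l; [lra | lra | rewrite ltn_expl].
Qed.

End Slice.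

Lemma kraft_neh N :
  \sum_(m : {set haar_index N} | `[< neh_models m >]) expR (- 6 * #|m|%:R) <= 1 :> R.
Proof.
apply: (@le_trans _ _ (\sum_(J < N) \sum_(m : {set haar_index N} | `[< neh_slice J m >])
   expR (- 6 * #|m|%:R))).
  rewrite [leLHS]big_mkcond; under [leRHS]eq_bigr => J _ do rewrite big_mkcond.
  rewrite exchange_big; apply: ler_sum => m _ /=.
  have pos J : 0 <= (if `[< neh_slice J m >] then expR (- 6 * #|m|%:R) else 0) :> R.
    by case: ifP => // _; exact: expR_ge0.
  case: ifP => [/asboolP[J [JN mJ]]|_]; last exact: sumr_ge0.
  rewrite (bigD1 (Ordinal JN)) //= ifT; last exact/asboolP.
  by rewrite lerDl sumr_ge0.
apply: (@le_trans _ _ (\sum_(J < N) 2^-1 ^+ J.+1)).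
  by apply: ler_sum => J _; exact: kraft_slice.
under eq_bigr => J _ do rewrite exprS.
by rewrite -mulr_sumr; have := sum_geo_half N; lra.
Qed.

End Kraft.

(** * The law of a categorical sample *)

Section CategoricalSample.
Context d (T : measurableType d) (R : realType) (P : probability T R).
Variables (r n : nat) (X : T -> 'M[R]_(r, n)) (s : 'M[R]_(r, n)).
Hypothesis Xs : categorical_sample P X s.
Local Notation labels := {ffun 'I_n -> 'I_r}.

Definition onehot (f : labels) : 'M[R]_(r, n) := \matrix_(a, i) (f i == a)%:R.

Definition label_event a i : set T := [set w | X w a i = 1].

Definition labels_event (f : labels) : set T :=
  \bigcap_(i in [set` [set: 'I_n]%SET]) label_event (f i) i.

Lemma measurable_label_event a i : measurable (label_event a i).
Proof.
have [mX _ _ _ _] := Xs.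
rewrite (_ : label_event a i = setT `&` (fun w => X w a i) @^-1` [set 1]).
  exact: mX.
by rewrite setTI.
Qed.

Lemma measurable_labels_event f : measurable (labels_event f).
Proof.
by apply: fin_bigcap_measurable => // i _; exact: measurable_label_event.
Qed.

Lemma entry_indic w a i : X w a i = \1_(label_event a i) w.
Proof.
have [_ X01 _ _ _] := Xs; rewrite indicE; case: (X01 w a i) => Xw; rewrite Xw.
  by rewrite memNset // /label_event /= Xw => /esym/eqP; rewrite oner_eq0.
by rewrite mem_set.
Qed.

Lemma label_event_prob a i : P (label_event a i) = (s a i)%:E.
Proof.
have [_ _ _ _ <-] := Xs; rewrite -(expectation_indic P (measurable_label_event a i)).
by congr expectation; apply/funext => w; rewrite entry_indic.
Qed.

Lemma mean_ge0 a i : 0 <= s a i.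
Proof. by rewrite -lee_fin -label_event_prob. Qed.

Lemma mean_sum1 i : \sum_a s a i = 1.
Proof.
have [_ _ Xsum _ _] := Xs; apply: EFin_inj; rewrite -sumEFin.
have sE a : (s a i)%:E = (\int[P]_w (\1_(label_event a i) w)%:E)%E.
  by rewrite -label_event_prob integral_indic ?setIT //; exact: measurable_label_event.
under eq_bigr => a _ do rewrite sE.
rewrite -(@ge0_integral_sum _ _ _ P setT measurableT _
  (fun a w => (\1_(label_event a i) w)%:E)) //.
  rewrite -[RHS](@probability_setT _ _ _ P) -[RHS]mul1e -integral_cst //.
  apply: eq_integral => w _; rewrite sumEFin -(Xsum w i) /cst; congr _%:E.
  by apply: eq_bigr => a _; rewrite entry_indic.
by move=> a; apply/measurable_EFinP/measurable_indic/measurable_label_event.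
Qed.

Lemma labels_event_prob f : P (labels_event f) = (\prod_i s (f i) i)%:E.
Proof.
have [_ _ _ indep _] := Xs; rewrite /labels_event indep; last first.
  move=> i _; apply: sub_sigma_algebra; exists (f i) => //.
  by exists [set 1] => //; rewrite setTI.
rewrite -prodEFin [LHS](eq_bigl xpredT) => [|i]; last by rewrite finset.in_setT.
by apply: eq_bigr => i _; rewrite label_event_prob.
Qed.

Lemma labels_event_onehot f w : labels_event f w <-> X w = onehot f.
Proof.
have [_ X01 Xsum _ _] := Xs; split=> [fw|Xw i _]; last first.
  by rewrite /label_event /= Xw mxE eqxx.
apply/matrixP => a i; rewrite mxE.
have Xfi : X w (f i) i = 1 by apply: fw => /=; rewrite inE.
case: eqP => [<-//|fa]; case: (X01 w a i) => // Xai.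
have : \sum_b X w b i >= 2.
  rewrite (bigD1 (f i)) //= (bigD1 a) /=; last by apply/eqP => /esym.
  rewrite Xfi Xai -[2]/(1 + 1) lerD2l lerDl sumr_ge0 // => b _.
  by case: (X01 w b i) => ->.
by rewrite Xsum; lra.
Qed.

Lemma onehot_inj : injective onehot.
Proof.
move=> f g fg; apply/ffunP => i; have /matrixP/(_ (f i) i) := fg.
by rewrite !mxE eqxx; case: eqP => // _ /eqP; rewrite oner_eq0.
Qed.

Lemma sample_onehot w : exists f, X w = onehot f.
Proof.
have [_ X01 Xsum _ _] := Xs.
have lab i : exists a, X w a i == 1.
  apply/existsP; apply: contraT; rewrite negb_exists => /forallP none.
  have := Xsum w i; rewrite big1 => [/esym/eqP|a _]; first by rewrite oner_eq0.
  by case: (X01 w a i) => // Xai; have := none a; rewrite Xai eqxx.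
exists [ffun i => xchoose (lab i)]; apply/labels_event_onehot => i _.
by rewrite ffunE; exact/eqP/(xchooseP (lab i)).
Qed.

Lemma sample_fun_sum (G : 'M[R]_(r, n) -> R) w :
  G (X w) = \sum_(f : labels) G (onehot f) * \1_(labels_event f) w.
Proof.
have [f Xw] := sample_onehot w; rewrite (bigD1 f) //= big1 ?addr0 => [|g gf].
  by rewrite indicE mem_set ?mulr1 -?Xw //; exact/labels_event_onehot.
rewrite indicE memNset ?mulr0 // => /labels_event_onehot; rewrite Xw => /onehot_inj fg.
by rewrite fg eqxx in gf.
Qed.

(** The sample takes finitely many values, so that any function of it is a linear
    combination of indicators of measurable events. *)
Lemma measurable_sample_fun (G : 'M[R]_(r, n) -> R) :
  measurable_fun setT (fun w => G (X w)).
Proof.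
rewrite (_ : (fun w => _) = fun w => \sum_(f : labels) G (onehot f) * \1_(labels_event f) w).
  apply: measurable_sum => f; apply: measurable_funM => //.
  exact/measurable_indic/measurable_labels_event.
by apply/funext => w; rewrite sample_fun_sum.
Qed.

Lemma expectation_sample (G : 'M[R]_(r, n) -> R) : (forall x, 0 <= G x) ->
  ('E_P[fun w => G (X w)] = (prodE s (fun f => G (onehot f)))%:E)%E.
Proof.
move=> G0; rewrite unlock.
under eq_integral => w _ do rewrite sample_fun_sum -sumEFin.
have mi f : measurable_fun setT (fun w => (\1_(labels_event f) w : R)%:E).
  exact/measurable_EFinP/measurable_indic/measurable_labels_event.
rewrite ge0_integral_sum //; last 2 first.
- move=> f; under eq_fun => w do rewrite EFinM.
  exact: emeasurable_funM.
- by move=> f w _; rewrite lee_fin mulr_ge0.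
rewrite /prodE -sumEFin; apply: eq_bigr => f _.
under eq_integral => w _ do rewrite EFinM.
rewrite ge0_integralZl_EFin //.
rewrite integral_indic ?setIT //; last exact: measurable_labels_event.
by rewrite mulrC EFinM -labels_event_prob.
Qed.

End CategoricalSample.

(** * The oracle inequality *)

Section OracleInequality.
Variables (R : realType) (n : nat) (I : finType) (phi : I -> 'rV[R]_n).
Hypothesis phi_on : forall l l', phi l *m (phi l')^T = (l == l')%:R%:M.
Variables (r : nat) (s x : 'M[R]_(r, n)).
Local Notation Pi := (proj_mx phi).

Lemma contrastE (t : 'M[R]_(r, n)) : contrast x t = mxsqnorm (x - t) - mxsqnorm x.
Proof. by rewrite /contrast /mxsqnorm !mxdot_linear (mxdotC t x); ring. Qed.

Lemma contrast_proj_le m : contrast x (x *m Pi m) <= contrast x (s *m Pi m).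
Proof.
rewrite !contrastE lerD2r [leRHS](pythagoras_proj_mx phi_on m).
rewrite !mulmxBl -mulmxA (proj_mx_idem phi_on) opprB addrA subrK.
by rewrite lerDl mxsqnorm_ge0.
Qed.

Lemma loss_proj m :
  mxsqnorm (s - x *m Pi m) = mxsqnorm (s - s *m Pi m) + quad (Pi m) (x - s).
Proof.
rewrite quad_proj_mx // [LHS](pythagoras_proj_mx phi_on m).
rewrite !mulmxBl -mulmxA (proj_mx_idem phi_on) opprB addrA subrK.
by congr (_ + _); rewrite -mxsqnormN opprB.
Qed.

(** The difference of the two estimators lies in the span of [m :|: m'], so its
    inner product with the noise is bounded by the projection of the noise on
    this span. Young's inequality with factor 4 lets half of the loss be absorbed
    in the left-hand side. *)
Lemma penalized_loss_le m m' (pen pen' : R) :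
  contrast x (x *m Pi m') + pen' <= contrast x (x *m Pi m) + pen ->
  mxsqnorm (s - x *m Pi m') <=
    3 * mxsqnorm (s - s *m Pi m) + 8 * quad (Pi m) (x - s) + 2 * pen +
    2 * (4 * quad (Pi m') (x - s) - pen').
Proof.
have := contrast_proj_le m; rewrite !contrastE.
set e := x - s; set st := x *m Pi m'; set sm := s *m Pi m => min_m min_pen.
pose U := m :|: m'; pose w := st - sm.
have wU : w *m Pi U = w.
  by rewrite mulmxBl -!mulmxA !(proj_mx_sub phi_on) ?finset.subsetUl ?finset.subsetUr.
have ew : 2 * mxdot e w <= 4 * quad (Pi U) e + 4^-1 * mxsqnorm w.
  rewrite -[in leLHS]wU mxdotC mxdot_adjoint tr_proj_mx mxdotC quad_proj_mx //.
  exact: mxdot_young.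
have eU := quad_proj_mxU phi m m' e.
have ws : mxsqnorm w <= 2 * mxsqnorm (s - st) + 2 * mxsqnorm (s - sm).
  have := mxsqnorm_ge0 ((s - st) + (s - sm)).
  have -> : w = (s - sm) - (s - st) by rewrite opprB addrC addrA subrK.
  rewrite /mxsqnorm !(mxdotDl (s - _)) !(mxdotDr _ (s - _)) !mxdotNl !mxdotNr.
  rewrite (mxdotC (s - sm)); lra.
have split_e t : mxsqnorm (x - t) = mxsqnorm (s - t) + 2 * mxdot e (s - t) + mxsqnorm e.
  have -> : x - t = (s - t) + e by rewrite /e [RHS]addrC addrA subrK.
  by rewrite /mxsqnorm !(mxdotDl _ e) !(mxdotDr _ _ e) (mxdotC (s - t) e); ring.
have ewE : mxdot e w = mxdot e (s - sm) - mxdot e (s - st).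
  by rewrite /w !mxdotDr !mxdotNr; ring.
move: min_m min_pen ew eU ws; rewrite ewE (split_e sm) (split_e st).
move: (mxsqnorm w) (mxsqnorm (s - st)) (mxsqnorm (s - sm)) (mxsqnorm e).
move: (mxsqnorm x) (mxsqnorm (x - _)) (mxdot e _) (mxdot e _).
by move: (quad _ e) (quad _ e) (quad _ e) => *; lra.
Qed.

End OracleInequality.

Section RiskBounds.
Variables (R : realType) (N r : nat) (s : 'M[R]_(r.+1, 2 ^ N)).
Hypothesis s_ge0 : forall a i, 0 <= s a i.
Hypothesis s_sum1 : forall i, \sum_a s a i = 1.
Local Notation Pi := (proj_mx (@haar_vec R N)).

Lemma proj_estimatorE (x : 'M[R]_(r.+1, 2 ^ N)) m : proj_estimator x m = x *m Pi m.
Proof. exact: (orthoproj_proj_mx (@haar_orthonormal R N)). Qed.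

Lemma dim_haar_span (m : {set haar_index N}) : \dim (haar_span R m) = #|m|.
Proof. exact: (dim_span_of (@haar_orthonormal R N)). Qed.

(** A bound on the loss that depends on the sample but not on the selected model:
    the excess of chi over the penalty, at the selected model, is replaced by a
    sum of exponentials over all the models. *)
Definition risk_majorant (c : R) (m : {set haar_index N}) (x : 'M[R]_(r.+1, 2 ^ N)) : R :=
  3 * mxsqnorm (s - s *m Pi m) + 8 * quad (Pi m) (x - s) + 2 * (c * #|m|%:R) +
  \sum_(m' : {set haar_index N} | `[< neh_models m' >])
     256 * expR (- (c * #|m'|%:R) / 128) * expR (quad (Pi m') (x - s) / 32).

Lemma risk_majorant_ge0 c m x : 0 <= c -> 0 <= risk_majorant c m x.
Proof.
move=> c0; rewrite /risk_majorant !addr_ge0 //.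
- by rewrite mulr_ge0 ?mxsqnorm_ge0.
- by rewrite mulr_ge0 // (quad_proj_mx (@haar_orthonormal R N)) mxsqnorm_ge0.
- by rewrite !mulr_ge0.
- by apply: sumr_ge0 => m' _; rewrite mulr_ge0 ?mulr_ge0 ?expR_ge0 ?ler0n.
Qed.

Lemma loss_le_majorant (c : R) x m mhat : minimizes_crit c x mhat -> neh_models m ->
  mxsqnorm (s - proj_estimator x mhat) <= risk_majorant c m x.
Proof.
move=> [hat_model hat_min] m_model; have := hat_min m m_model.
rewrite /penalized_crit !proj_estimatorE !dim_haar_span.
move=> /(penalized_loss_le (@haar_orthonormal R N) s) /le_trans; apply.
rewrite /risk_majorant lerD2l.
rewrite (bigD1 mhat) /=; last exact/asboolP.
(* y <= 128 exp (y / 128), where y / 128 has the coefficient 1 / 32 of the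
   exponential moment in front of chi. *)
set y := 4 * _ - _; apply: (@le_trans _ _ (256 * expR (y / 128))).
  by have := expR_ge1Dx (y / 128); lra.
rewrite -mulrA -expRD (_ : - (c * #|mhat|%:R) / 128 + quad _ _ / 32 = y / 128); last first.
  by rewrite /y; field.
by rewrite lerDl; apply: sumr_ge0 => m' _; rewrite mulr_ge0 ?mulr_ge0 ?expR_ge0 ?ler0n.
Qed.

Lemma onehot_noise f : onehot R f - s = noise s f.
Proof. by apply/matrixP => a i; rewrite !mxE. Qed.

Lemma models_card_gt0 (m : {set haar_index N}) : neh_models m -> (1 <= #|m|)%N.
Proof. by move=> [J [JN /(slice_card_ge JN)]]; apply: leq_trans; rewrite expn_gt0. Qed.

(** With c >= 784 = 128 * (6 + 1/8), the penalty pays for the exponential moment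
    exp (|m'| / 8) and leaves exp (- 6 |m'|), which is summable by [kraft_neh].
    The factor 267 collects 3 for the bias, 8 for the variance and 256 for this
    sum, the last one being charged to |m| >= 1. *)
Lemma majorant_mean_le (c : R) m : 784 <= c -> neh_models m ->
  prodE s (fun f => risk_majorant c m (onehot R f)) <=
  (267 + 2 * c) * (mxsqnorm (s - s *m Pi m) + #|m|%:R).
Proof.
move=> c_ge m_model; set b := mxsqnorm _.
have cPi m' : contraction r.+1 (Pi m') := contraction_proj_mx (@haar_orthonormal R N) r.+1 m'.
have trPi m' : \tr (Pi m') = #|m'|%:R := trace_proj_mx (@haar_orthonormal R N) m'.
have -> : prodE s (fun f => risk_majorant c m (onehot R f)) =
    (3 * b + 2 * (c * #|m|%:R)) + 8 * prodE s (fun f => quad (Pi m) (noise s f)) +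
    \sum_(m' : {set haar_index N} | `[< neh_models m' >])
      256 * expR (- (c * #|m'|%:R) / 128) *
      prodE s (fun f => expR (quad (Pi m') (noise s f) / 32)).
  under [X in _ = _ + X]eq_bigr => m' _ do rewrite -prodEZ.
  rewrite -prodE_sum -prodEZ -[3 * b + _](prodE_cst s_sum1) -!prodED.
  by apply: eq_prodE => f; rewrite /risk_majorant onehot_noise; congr (_ + _); rewrite /b; ring.
have chi2 := quad_noise_mean_le s_sum1 (cPi m); rewrite trPi in chi2.
have D1 : 1 <= #|m|%:R :> R by rewrite ler1n models_card_gt0.
suff sum_le : \sum_(m' : {set haar_index N} | `[< neh_models m' >])
      256 * expR (- (c * #|m'|%:R) / 128) *
      prodE s (fun f => expR (quad (Pi m') (noise s f) / 32)) <= 256.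
  have b0 : 0 <= b by exact: mxsqnorm_ge0.
  have cb0 : 0 <= c * b by rewrite mulr_ge0 //; lra.
  lra.
apply: (@le_trans _ _ (\sum_(m' : {set haar_index N} | `[< neh_models m' >])
   256 * expR (- 6 * #|m'|%:R))); last first.
  by rewrite -mulr_sumr; have := kraft_neh R N; lra.
have c784 : 0 <= c - 784 by rewrite subr_ge0.
apply: ler_sum => m' _; rewrite -mulrA ler_wpM2l ?ler0n //.
have := quad_noise_mgf s_ge0 s_sum1 (cPi m'); rewrite trPi.
move=> /(ler_wpM2l (expR_ge0 (- (c * #|m'|%:R) / 128))) /le_trans; apply.
rewrite -expRD ler_expR; move: (#|m'|%:R : R) (ler0n R #|m'|) => D D0.
by have := mulr_ge0 c784 D0; lra.
Qed.

Lemma oracle_risk_ge (rho : R) m : (forall a i, s a i <= 1 - rho) ->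
  mxsqnorm (s - s *m Pi m) + rho * #|m|%:R <=
  prodE s (fun f => mxsqnorm (s - proj_estimator (onehot R f) m)).
Proof.
move=> s_rho; set b := mxsqnorm _.
have -> : prodE s (fun f => mxsqnorm (s - proj_estimator (onehot R f) m)) =
    b + prodE s (fun f => quad (Pi m) (noise s f)).
  rewrite -[b in RHS](prodE_cst s_sum1) -prodED; apply: eq_prodE => f.
  by rewrite proj_estimatorE (loss_proj (@haar_orthonormal R N)) onehot_noise.
rewrite lerD2l -(trace_proj_mx (@haar_orthonormal R N)).
by apply: quad_noise_mean_ge => //; exact: (contraction_proj_mx (@haar_orthonormal R N)).
Qed.

End RiskBounds.

Theorem proposition3 (R : realType) :
  exists kappa : R, 0 < kappa /\
  forall c : R, kappa <= c ->
  forall rho : R, 0 < rho ->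
  exists C : R, 0 < C /\
  forall (N r : nat), (1 <= N)%N -> (2 <= r)%N ->
  forall (d : measure_display) (T : measurableType d) (P : probability T R)
    (X : T -> 'M[R]_(r, 2 ^ N)) (s : 'M[R]_(r, 2 ^ N)),
  categorical_sample P X s ->
  (forall j i, s j i <= 1 - rho) ->
  forall mhat : T -> {set haar_index N},
  (forall m : {set haar_index N}, measurable [set w | mhat w = m]) ->
  (forall w : T, minimizes_crit c (X w) (mhat w)) ->
  ('E_P[fun w => mxsqnorm (s - proj_estimator (X w) (mhat w))] <=
   C%:E * ereal_inf
     [set 'E_P[fun w => mxsqnorm (s - proj_estimator (X w) m)]
       | m in @neh_models N])%E.
Proof.
exists 784; split=> [|c c_ge rho rho0]; first by rewrite ltr0n.
have c0 : 0 <= c by lra.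
have rhoV0 : 0 < rho^-1 by rewrite invr_gt0.
pose C := (267 + 2 * c) * (1 + rho^-1).
have C0 : 0 < C by apply: mulr_gt0; lra.
exists C; split=> [|N r _]; first exact: C0.
case: r => // r _ d T P X s Xs s_rho mhat mhat_meas mhat_min.
have s0 := mean_ge0 Xs; have s1 := mean_sum1 Xs.
rewrite -lee_pdivrMl ?C0 //; apply/ereal_infP => _ [m m_model <-].
rewrite lee_pdivrMl ?C0 //.
rewrite (expectation_sample Xs (G := fun x => mxsqnorm (s - proj_estimator x m)));
  last by move=> x; exact: mxsqnorm_ge0.
have majo : ('E_P[fun w => mxsqnorm (s - proj_estimator (X w) (mhat w))] <=
    'E_P[fun w => risk_majorant s c m (X w)])%E.
  (* The loss is a measurable function of [mhat] and [X], which take finitely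
     many values. *)
  apply: expectation_le.
  - rewrite (_ : (fun w => _) = fun w => \sum_(m' : {set haar_index N})
      mxsqnorm (s - proj_estimator (X w) m') * \1_[set w | mhat w = m'] w).
      apply: measurable_sum => m'; apply: measurable_funM.
        exact: (measurable_sample_fun Xs (fun x => mxsqnorm (s - proj_estimator x m'))).
      exact: measurable_indic.
    apply/funext => w; rewrite (bigD1 (mhat w)) //= big1 => [|m' m'w].
      by rewrite indicE mem_set // mulr1 addr0.
    by rewrite indicE memNset ?mulr0 // => /= wm'; rewrite wm' eqxx in m'w.
  - exact: (measurable_sample_fun Xs).
  - by move=> w; exact: mxsqnorm_ge0.
  - by move=> w; exact: risk_majorant_ge0.
  - by apply: aeW => w; exact: loss_le_majorant.
apply: (le_trans majo).
rewrite (expectation_sample Xs) => [|x]; last exact: risk_majorant_ge0.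
rewrite -EFinM lee_fin (le_trans (majorant_mean_le s0 s1 c_ge m_model)) //.
have := oracle_risk_ge s0 s1 m s_rho.
move=> /(ler_wpM2l (ltW C0)); apply: le_trans.
rewrite /C -mulrA; apply: ler_wpM2l; first by lra.
set b := mxsqnorm _; have b0 : 0 <= b by exact: mxsqnorm_ge0.
have rb : 0 <= rho^-1 * b by rewrite mulr_ge0 // ltW.
have rD : 0 <= rho * #|m|%:R by rewrite mulr_ge0 // ltW.
have -> : (1 + rho^-1) * (b + rho * #|m|%:R) =
    b + #|m|%:R * (rho^-1 * rho) + rho^-1 * b + rho * #|m|%:R by ring.
by rewrite mulVf ?gt_eqF //; lra.
Qed.
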